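(* Let $m\ge2$, $n\ge1$, let $\gamma\colon I\to\mathbb{R}^{m+n}$ be a smooth regular embedded curve on an interval $I$, and let $\mathscr{D}$ be a smooth distribution of rank $m$ along $\gamma$ with $\dot\gamma(t)\in\mathscr{D}_t$ for all $t\in I$. Assume that the function $\pi^{\perp}(\overline{D}_t\dot\gamma)$ is never zero and that there exists a smooth orthonormal frame $(N_1^{\ast},\dots,N_n^{\ast})$ for $\mathscr{D}^{\perp}$ such that $\pi^{\top}(\overline{D}_tN_k^{\ast})=0$ for all but one value $s$ of $k\in\{1,\dots,n\}$. If $\pi^{\perp}(\overline{D}_tN_s^{\ast})=0$, then the solution of the geometric Cauchy problem for rank-one submanifolds of $\mathbb{R}^{m+n}$ with data $(\gamma,\mathscr{D})$ is not full. In particular, it is a hypersurface in an $(m+1)$-dimensional affine subspace of $\mathbb{R}^{m+n}$.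
   Context: A distribution of rank $m$ along $\gamma$ is a smooth rank-$m$ subbundle of $T\mathbb{R}^{m+n}|_\gamma=\bigsqcup_{t\in I}T_{\gamma(t)}\mathbb{R}^{m+n}$. $\mathscr{D}^{\perp}$ is its Euclidean orthogonal complement, $\pi^{\top}$ and $\pi^{\perp}$ are the orthogonal projections onto $\mathscr{D}$ and $\mathscr{D}^{\perp}$, and $\overline{D}_t$ is the Euclidean covariant derivative along $\gamma$ (componentwise $t$-derivative). An $m$-dimensional embedded submanifold $M$ of $\mathbb{R}^{m+n}$ with second fundamental form $\alpha$ is rank-one if at every $p\in M$ the nullity space $\{x\in T_pM\mid\alpha(x,\cdot)=0\}$ has dimension $m-1$. The geometric Cauchy problem for rank-one submanifolds with data $(\gamma,\mathscr{D})$ is to find an $m$-dimensional rank-one submanifold $M$ of $\mathbb{R}^{m+n}$ containing $\gamma(I)$ with $T_{\gamma(t)}M=\mathscr{D}_t$ for all $t\in I$. Under the first two assumptions of the claim, a solution exists and any two solutions coincide on an open set containing $\gamma(I)$; ''the solution'' is understood as this locally unique submanifold in a neighborhood of $\gamma(I)$. There it is the union over $t\in I$ of neighborhoods of $\gamma(t)$ in the affine subspaces $\gamma(t)+\bigl(\mathscr{D}_t\cap(\operatorname{Im}\rho_t)^{\perp}\bigr)$, where $\rho_t\colon\mathscr{D}_t^{\perp}\to\mathscr{D}_t$ is given by $\rho_t(\nu)=\pi^{\top}(\overline{D}_t\nu)$ for any smooth extension of $\nu$ to a local section of $\mathscr{D}^{\perp}$. A submanifold of $\mathbb{R}^{m+n}$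 is full if it is not contained in any totally geodesic submanifold of dimension less than $m+n$ (equivalently, in any affine subspace of dimension less than $m+n$).
   Formalization: The interval I is taken to be open and nonempty (with a closed endpoint the solution is not locally unique and the claim can fail), and ''not full'' is claimed only for n ≥ 2, since it is false for n = 1; the hypersurface clause is kept for all n ≥ 1. *)

(* Defs.v *)
From mathcomp Require Import all_boot all_order all_algebra.
From mathcomp Require Import all_classical all_reals all_analysis.

Set Implicit Arguments.
Unset Strict Implicit.
Unset Printing Implicit Defensive.

Import Order.TTheory GRing.Theory Num.Theory.
Import numFieldNormedType.Exports.

Local Open Scope classical_set_scope.
Local Open Scope ring_scope.

(* Points and vectors of R^N are row vectors 'rV[R]_N; a linear subspace of R^N
   is the row space of a matrix. The norm on 'rV[R]_N is the sup norm, which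
   induces the usual topology and derivatives; all Euclidean notions below go
   through the scalar product u *m v^T. *)

Section Smooth.
Context {R : realType} {V W : normedModType R}.

(* For V finite-dimensional and U open, differentiability of f together with
   C^k regularity of all its directional derivatives is C^(k+1) regularity. *)
Fixpoint cont_diff (k : nat) (U : set V) (f : V -> W) : Prop :=
  match k with
  | 0 => forall x, U x -> {for x, continuous f}
  | k'.+1 => (forall x, U x -> differentiable f x) /\
             (forall v : V, cont_diff k' U ('D_v f))
  end.

Definition smooth (U : set V) (f : V -> W) : Prop :=
  forall k, cont_diff k U f.

End Smooth.

Section Linear.
Context {R : realType} {N : nat}.
Implicit Types (S : set 'rV[R]_N) (A D : 'M[R]_N).

(* u *m D^T lists the scalar products of u with the rows of D. *)
Definition orth_compl D : 'M[R]_N := kermx D^T.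

Definition proj_top D (v : 'rV[R]_N) : 'rV[R]_N :=
  v *m proj_mx D (orth_compl D).

Definition proj_perp D (v : 'rV[R]_N) : 'rV[R]_N :=
  v *m proj_mx (orth_compl D) D.

Definition linear_subspace_of_dim (d : nat) S : Prop :=
  exists A, \rank A = d /\ S = [set v | (v <= A)%MS].

Definition affine_subspace (p : 'rV[R]_N) A : set 'rV[R]_N :=
  [set x | (x - p <= A)%MS].

Definition full S : Prop :=
  ~ exists p A, (\rank A < N)%N /\ S `<=` affine_subspace p A.

End Linear.

Section Submanifolds.
Context {R : realType} {m n : nat}.
Implicit Types (M : set 'rV[R]_(m + n)) (p x y z v : 'rV[R]_(m + n)).

(* Local slice condition: around each of its points, M is carried to
   R^m x {0} by a smooth diffeomorphism f : U -> V, with inverse g, between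
   open subsets of R^(m+n). *)
Definition embedded_submanifold M : Prop :=
  forall p, M p ->
  exists (U V : set 'rV[R]_(m + n)) (f g : 'rV[R]_(m + n) -> 'rV[R]_(m + n)),
    [/\ [/\ open U, U p & open V],
        smooth U f /\ smooth V g,
        (forall q, U q -> V (f q) /\ g (f q) = q),
        (forall w, V w -> U (g w) /\ f (g w) = w) &
        (forall q, U q -> (M q <-> rsubmx (f q) = 0))].

Definition tangent_space M p : set 'rV[R]_(m + n) :=
  [set v | exists (c : R -> 'rV[R]_(m + n)) (e : R),
    [/\ 0 < e, smooth [set` `]- e, e[] c,
        (forall t, t \in `]- e, e[ -> M (c t)),
        c 0 = p & derive1 c 0 = v]].

Definition normal_to M p z : Prop :=
  forall v, tangent_space M p v -> z *m v^T = 0.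

(* Graph of the second fundamental form: z = alpha(x, y) is the normal part of
   the derivative at p in the direction x of a smooth local extension Y of y
   to a tangent vector field of M. The field Y is given by a smooth map on an
   open subset of the ambient space; every smooth tangent field of an embedded
   submanifold is locally of this form. *)
Definition second_fundamental_form M p x y z : Prop :=
  exists (U : set 'rV[R]_(m + n)) (Y : 'rV[R]_(m + n) -> 'rV[R]_(m + n)),
    [/\ open U /\ U p, smooth U Y,
        (forall q, U q -> M q -> tangent_space M q (Y q)),
        Y p = y &
        tangent_space M p ('D_x Y p - z) /\ normal_to M p z].

Definition nullity_space M p : set 'rV[R]_(m + n) :=
  [set x | tangent_space M p x /\
    forall y z, tangent_space M p y ->
      second_fundamental_form M p x y z -> z = 0].

Definition rank_one_submanifold M : Prop :=
  embedded_submanifold M /\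
  forall p, M p -> linear_subspace_of_dim (m - 1) (nullity_space M p).

(* M being m-dimensional, it has codimension one in an (m+1)-dimensional affine
   subspace that contains it. *)
Definition hypersurface_of_affine_subspace M p (A : 'M[R]_(m + n)) : Prop :=
  [/\ embedded_submanifold M, \rank A = m.+1 & M `<=` affine_subspace p A].

End Submanifolds.

Section Cauchy.
Context {R : realType} {m n : nat}.
Implicit Types (I : set R) (gamma : R -> 'rV[R]_(m + n))
  (D : R -> 'M[R]_(m + n)).

(* The last clause is continuity of the inverse gamma(I) -> I. *)
Definition regular_embedded_curve I gamma : Prop :=
  [/\ smooth I gamma,
      (forall t, I t -> derive1 gamma t != 0),
      (forall s t, I s -> I t -> gamma s = gamma t -> s = t) &
      (forall t, I t -> forall e : R, 0 < e -> exists2 d : R, 0 < d &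
         forall s, I s -> `|gamma s - gamma t| < d -> `|s - t| < e)].

(* The fibre over t is the row space of D t; only this row space matters, so
   smoothness is expressed by local frames (the rows of E) and not by the
   matrices D t. *)
Definition smooth_distribution I D : Prop :=
  forall t, I t -> exists (J : set R) (E : R -> 'M[R]_(m, m + n)),
    [/\ open J, J t, J `<=` I, smooth J E &
        forall s, J s -> row_free (E s) /\ (E s == D s)%MS].

Definition smooth_orthonormal_normal_frame I D
    (N : 'I_n -> R -> 'rV[R]_(m + n)) : Prop :=
  (forall k, smooth I (N k)) /\
  (forall t, I t -> let F := \matrix_(k < n) N k t in
     F *m F^T = 1%:M /\ (F == orth_compl (D t))%MS).

Definition cauchy_solution I gamma D (M : set 'rV[R]_(m + n)) : Prop :=
  [/\ rank_one_submanifold M,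
      (forall t, I t -> M (gamma t)) &
      (forall t, I t -> tangent_space M (gamma t) = [set v | (v <= D t)%MS])].

End Cauchy.

(* Main.v *)
(* Let W be the span of the normals [N k], [k != s]. Differentiating the
   orthonormality relations and using the two hypotheses on the frame shows that W
   is parallel along the curve, hence a constant subspace orthogonal to every D_t;
   its orthogonal complement is the direction of the affine subspace A, of dimension
   m + 1, and gamma stays in A.

   That M stays in A near gamma does not require integrating the nullity
   distribution. In a chart, the Gauss map G (a basis of the tangent space normalized
   against a fixed complement) is annihilated by the directions in the nullity
   space, so the gradients of all its entries are proportional. Some combination h
   of the entries has nonzero derivative along gamma, because
   pi^perp(D_t gamma') <> 0. Hence every point close to gamma lies on the level set
   of h through a point of gamma, and the entries of G are locally functions of h:
   as W is orthogonal to the tangent spaces along gamma, it is orthogonal to the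
   nearby tangent spaces of M as well. *)

From HB Require Import structures.
Require Import Defs.
From mathcomp Require Import all_boot all_order all_algebra ring lra.
From mathcomp Require Import all_classical all_reals all_analysis.

Set Implicit Arguments.
Unset Strict Implicit.
Unset Printing Implicit Defensive.

Import Order.TTheory GRing.Theory Num.Theory.
Import numFieldNormedType.Exports.

Local Open Scope classical_set_scope.
Local Open Scope ring_scope.

(** * Closure properties of [C^k] maps on open sets *)

Section ContDiff.
Context {R : realType}.

Lemma near_eq_diff (V W : normedModType R) (f g : V -> W) (x : V) :
  (\near x, f x = g x) -> differentiable f x ->
  differentiable g x /\ 'd g x = 'd f x :> (V -> W).
Proof.
move=> fg df; have fgx := nbhs_singleton fg.
(* The first-order expansion only sees the germ, so [g] inherits that of [f], and uniqueness of the
   differential identifies the two. *)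
have E : g \o shift x = cst (g x) + 'd f x +o_ 0 id.
  apply/eqaddoP => _/posnumP[e].
  have /eqaddoP/(_ e%:num (gt0 e)) := diff_locally df.
  have : \forall h \near 0, f (h + x) = g (h + x).
    by move/nbhs0P : fg; apply: filterS => h; rewrite addrC.
  by apply: filterS2 => h E; rewrite !fctE /= E fgx.
have D : 'd g x = 'd f x :> (V -> W).
  by apply: diff_unique => //; exact: diff_continuous.
by split=> //; apply/diff_locallyP; rewrite D; split => //; exact: diff_continuous.
Qed.

Lemma is_diff_scale (V W : normedModType R) (a : V -> R) (w : V -> W) (x : V) :
  differentiable a x -> differentiable w x ->
  is_diff x (fun y => a y *: w y)
    (fun v => a x *: 'd w x v + 'd a x v *: w x).
Proof.
move=> da dw.
(* Scaling is packed as a continuous bilinear map, whose differential is known, and then composed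
   with the pair [(a, w)]. *)
have bl : bilinear_for (GRing.Scale.Law.clone _ _ *:%R _)
    (GRing.Scale.Law.clone _ _ *:%R _) (fun (k : R) (u : W) => k *: u).
  by split=> [u|k] c y z /=; rewrite ?scalerDl ?scalerDr !scalerA // [k * c]mulrC.
pose blM := bilinear_isBilinear.Build R R W W _ _ _ bl.
pose b : {bilinear R -> W -> W} := HB.pack (fun (k : R) (u : W) => k *: u) blM.
have cb : continuous (fun p : R * W => b p.1 p.2) by exact: scale_continuous.
have H : is_diff (a x, w x) (fun q : R * W => q.1 *: q.2)
    (fun q => a x *: q.2 + q.1 *: w x).
  by apply: DiffDef; [exact: differentiable_bilin cb|exact: diff_bilin cb].
have P : is_diff x (fun y => (a y, w y)) (fun y => ('d a x y, 'd w x y)).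
  exact: is_diff_pair.
exact: (is_diff_comp P H).
Qed.

Lemma derive_scale (V W : normedModType R) (a : V -> R) (w : V -> W) (x v : V) :
  differentiable a x -> differentiable w x ->
  'D_v (fun y => a y *: w y) x = a x *: 'D_v w x + 'D_v a x *: w x.
Proof.
move=> da dw; have [D E] := is_diff_scale da dw.
by rewrite deriveE// E !deriveE.
Qed.

Lemma differentiable_scale (V W : normedModType R) (a : V -> R) (w : V -> W) x :
  differentiable a x -> differentiable w x ->
  differentiable (fun y => a y *: w y) x.
Proof. by move=> da dw; have [] := is_diff_scale da dw. Qed.

Lemma derive_comp (V V' W : normedModType R) (f : V -> V') (g : V' -> W) x v :
  differentiable f x -> differentiable g (f x) ->
  'D_v (fun y => g (f y)) x = 'D_('D_v f x) g (f x).
Proof.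
move=> df dg; rewrite [LHS](deriveE v (differentiable_comp df dg)) diff_comp//=.
by rewrite -(deriveE v df) -deriveE.
Qed.

Lemma cont_diff_continuous (V W : normedModType R) k (U : set V) (f : V -> W) :
  cont_diff k U f -> forall x, U x -> {for x, continuous f}.
Proof.
by case: k => [//|k] /= [df _] x Ux; exact/differentiable_continuous/df.
Qed.

Lemma cont_diffS (V W : normedModType R) k (U : set V) (f : V -> W) :
  cont_diff k.+1 U f -> cont_diff k U f.
Proof.
elim: k f => [f /cont_diff_continuous//|k IH f [df Df]].
by split=> // v; exact/IH/Df.
Qed.

Lemma cont_diff_sub (V W : normedModType R) k (U U' : set V) (f : V -> W) :
  U' `<=` U -> cont_diff k U f -> cont_diff k U' f.
Proof.
move=> UU; elim: k f => [f cf x /UU|k IH f [df Df]]; first exact: cf.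
by split=> [x /UU|v]; [exact: df|exact/IH/Df].
Qed.

Lemma near_open (V : normedModType R) (U : set V) (x : V) :
  open U -> U x -> \forall y \near x, U y.
Proof. by move=> oU Ux; exact: open_nbhs_nbhs. Qed.

(** On an open set, pointwise agreement is agreement of germs, so the directional derivatives agree
    on [U] as well and the induction proceeds. This allows a derivative to be replaced by a formula
    valid on [U] only. *)
Lemma eq_cont_diff (V W : normedModType R) k (U : set V) (f g : V -> W) :
  open U -> (forall x, U x -> f x = g x) -> cont_diff k U f -> cont_diff k U g.
Proof.
move=> oU; elim: k f g => [f g fg cf x Ux|k IH f g fg [df Df]].
  rewrite /prop_for /continuous_at -(fg _ Ux); apply: cvg_trans (cf x Ux).
  by apply: near_eq_cvg; apply: filterS (near_open oU Ux) => y /fg.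
have nfg x : U x -> \near x, f x = g x.
  by move=> Ux; apply: filterS (near_open oU Ux) => y /fg.
split=> [x Ux|v]; first by case: (near_eq_diff (nfg x Ux) (df x Ux)).
by apply: (IH ('D_v f)); [move=> x Ux; exact: near_eq_derive (nfg x Ux)|exact: Df].
Qed.

Lemma cont_diff_cst (V W : normedModType R) k (U : set V) (w : W) :
  cont_diff k U (fun _ : V => w).
Proof.
elim: k w => [w x _|k IH w]; first exact: cst_continuous.
split=> [x _|v]; first exact: differentiable_cst.
rewrite (_ : 'D_v _ = fun _ => 0); first exact: IH.
by apply/funext => x; exact: derive_cst.
Qed.

Lemma cont_diffD (V W : normedModType R) k (U : set V) (f g : V -> W) :
  open U -> cont_diff k U f -> cont_diff k U g ->
  cont_diff k U (fun x => f x + g x).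
Proof.
move=> oU; elim: k f g => [f g cf cg x Ux|k IH f g [df Df] [dg Dg]].
  by apply: continuousD; [exact: cf|exact: cg].
split=> [x Ux|v]; first by apply: differentiableD; [exact: df|exact: dg].
apply: eq_cont_diff (IH _ _ (Df v) (Dg v)) => // x Ux.
by rewrite -deriveD//; apply: diff_derivable; [exact: df|exact: dg].
Qed.

Lemma cont_diff_sum (V W : normedModType R) k (U : set V) (I : Type)
    (r : seq I) (P : pred I) (f : I -> V -> W) :
  open U -> (forall i, P i -> cont_diff k U (f i)) ->
  cont_diff k U (fun x => \sum_(i <- r | P i) f i x).
Proof.
move=> oU Cf; elim: r => [|i r IH].
  apply: (@eq_cont_diff _ _ _ _ (fun=> 0)) => //; last exact: cont_diff_cst.
  by move=> x _; rewrite big_nil.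
apply: (@eq_cont_diff _ _ _ _
    (fun x => (if P i then f i x else 0) + \sum_(j <- r | P j) f j x)) => //.
  by move=> x _; rewrite big_cons; case: ifP; rewrite ?add0r.
apply: cont_diffD => //.
by case: (boolP (P i)) => [/Cf//|_]; exact: cont_diff_cst.
Qed.

Lemma cont_diff_scale (V W : normedModType R) k (U : set V) (a : V -> R)
    (w : V -> W) :
  open U -> cont_diff k U a -> cont_diff k U w ->
  cont_diff k U (fun x => a x *: w x).
Proof.
move=> oU; elim: k a w => [a w ca cw x Ux|k IH a w Ca Cw].
  exact: (cvgZ (ca x Ux) (cw x Ux)).
have [[da Da] [dw Dw]] := (Ca, Cw).
split=> [x Ux|v]; first exact: differentiable_scale (da x Ux) (dw x Ux).
apply: (@eq_cont_diff _ _ _ _ (fun x => a x *: 'D_v w x + 'D_v a x *: w x)) => //.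
  by move=> x Ux; rewrite derive_scale//; [exact: da|exact: dw].
apply: cont_diffD => //.
  by apply: IH; [exact: cont_diffS Ca|exact: Dw].
by apply: IH; [exact: Da|exact: cont_diffS Cw].
Qed.

Lemma cont_diffM (V : normedModType R) k (U : set V) (a b : V -> R) :
  open U -> cont_diff k U a -> cont_diff k U b ->
  cont_diff k U (fun x => a x * b x).
Proof. exact: cont_diff_scale. Qed.

Lemma cont_diff_prod (V : normedModType R) k (U : set V) (I : Type)
    (r : seq I) (P : pred I) (f : I -> V -> R) :
  open U -> (forall i, P i -> cont_diff k U (f i)) ->
  cont_diff k U (fun x => \prod_(i <- r | P i) f i x).
Proof.
move=> oU Cf; elim: r => [|i r IH].
  apply: (@eq_cont_diff _ _ _ _ (fun=> 1 : R)) => //; last exact: cont_diff_cst.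
  by move=> x _; rewrite big_nil.
apply: (@eq_cont_diff _ _ _ _
    (fun x => (if P i then f i x else 1) * \prod_(j <- r | P j) f j x)) => //.
  by move=> x _; rewrite big_cons; case: ifP; rewrite ?mul1r.
apply: cont_diffM => //.
by case: (boolP (P i)) => [/Cf//|_]; exact: cont_diff_cst.
Qed.

Lemma cont_diffV (V : normedModType R) k (U : set V) (a : V -> R) :
  open U -> (forall x, U x -> a x != 0) -> cont_diff k U a ->
  cont_diff k U (fun x => (a x)^-1).
Proof.
move=> oU a0; elim: k => [ca x Ux|k IH Ca].
  exact: (cvgV (a0 x Ux) (ca x Ux)).
have [da Da] := Ca; split=> [x Ux|v].
  by apply: differentiableV; [exact: da|exact: a0].
(* The derivative is a product that contains [a^-1] itself, covered one order lower by the induction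
   hypothesis. *)
apply: (@eq_cont_diff _ _ _ _
    (fun x => (-1 : R) * ((a x)^-1 * ((a x)^-1 * 'D_v a x)))) => //.
  move=> x Ux; rewrite deriveV ?a0//; last exact/diff_derivable/da.
  by rewrite mulN1r scaleNr mulrA -invfM -expr2.
have Ci := IH (cont_diffS Ca).
apply: cont_diffM => //; first exact: cont_diff_cst.
by apply: cont_diffM => //; apply: cont_diffM => //; exact: Da.
Qed.

Lemma cont_diff_linear (V V' W : normedModType R) k (U : set V) (f : V -> V')
    (L : {linear V' -> W}) :
  open U -> continuous L -> cont_diff k U f -> cont_diff k U (fun x => L (f x)).
Proof.
move=> oU cL; elim: k f => [f cf x Ux|k IH f [df Df]].
  by apply: (@continuous_comp _ _ _ f L); [exact: cf|exact: cL].
have dL y : differentiable L y by exact: linear_differentiable.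
split=> [x Ux|v].
  by apply: (@differentiable_comp _ _ _ _ f L) => //; exact: df.
apply: eq_cont_diff (IH _ (Df v)) => // x Ux.
by rewrite (derive_comp v (df x Ux) (dL (f x))) [RHS]deriveE// diff_lin.
Qed.

Lemma cont_diff_id (V : normedModType R) k (U : set V) :
  cont_diff k U (id : V -> V).
Proof.
case: k => [x _|k]; first exact: cvg_id.
split=> // v; rewrite (_ : 'D_v _ = fun=> v); first exact: cont_diff_cst.
by apply/funext => x; rewrite derive_id.
Qed.

Lemma diff_rowE (p : nat) (W : normedModType R) (g : 'rV[R]_p -> W) y v :
  differentiable g y ->
  'd g y v = \sum_(j < p) v 0 j *: 'D_(delta_mx 0 j) g y.
Proof.
move=> dg; rewrite {1}[v]row_sum_delta linear_sum.
by apply: eq_bigr => j _; rewrite linearZ/= deriveE.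
Qed.

Lemma cont_diff_mxP (V : normedModType R) (p q : nat) k (U : set V)
    (F : V -> 'M[R]_(p, q)) : open U ->
  cont_diff k U F <-> forall i j, cont_diff k U (fun x => F x i j).
Proof.
move=> oU; split=> [CF i j|CF].
  have @L : {linear 'M[R]_(p, q) -> R}.
    by exists (fun N : 'M[R]_(_, _) => N i j); do 2![eexists]; do ?[constructor];
     rewrite ?mxE// => ? *; rewrite ?mxE//; move=> ?; rewrite !mxE.
  by apply: (cont_diff_linear (L := L)) => // x; exact: coord_continuous.
have -> : F = fun x => \sum_i \sum_j F x i j *: delta_mx i j.
  by apply/funext => x; exact: matrix_sum_delta.
do 2![apply: cont_diff_sum => // ? _].
by apply: cont_diff_scale => //; exact: cont_diff_cst.
Qed.

(** [cont_diff] controls derivatives in fixed directions, whereas the chain rule differentiates [g]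
    in the moving direction ['D_v f x]. Expanding that direction in the basis of ['rV[R]_p] reduces
    to fixed directions, which is why the intermediate space consists of row vectors. *)
Lemma cont_diff_comp (V : normedModType R) (p : nat) (W : normedModType R) k
    (U : set V) (U' : set 'rV[R]_p) (f : V -> 'rV[R]_p) (g : 'rV[R]_p -> W) :
  open U -> (forall x, U x -> U' (f x)) ->
  cont_diff k U f -> cont_diff k U' g -> cont_diff k U (fun x => g (f x)).
Proof.
move=> oU fU; elim: k f g fU => [f g fU cf cg x Ux|k IH f g fU Cf Cg].
  by apply: (@continuous_comp _ _ _ f g); [exact: cf|exact/cg/fU].
have [[df Df] [dg Dg]] := (Cf, Cg).
have dgf x : U x -> differentiable (g \o f) x.
  by move=> Ux; apply: differentiable_comp; [exact: df|exact/dg/fU].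
split=> [x /dgf//|v].
apply: (@eq_cont_diff _ _ _ _
    (fun x => \sum_(j < p) 'D_v f x 0 j *: 'D_(delta_mx 0 j) g (f x))) => //.
  move=> x Ux; rewrite [RHS]deriveE; last exact: dgf.
  rewrite diff_comp/=; [|exact: df|exact/dg/fU].
  by rewrite diff_rowE; [rewrite deriveE//; exact: df|exact/dg/fU].
apply: cont_diff_sum => // j _; apply: cont_diff_scale => //.
  by have /(cont_diff_mxP _ _ oU) := Df v; exact.
by apply: (IH f ('D_(delta_mx 0 j) g)) => //; [exact: cont_diffS Cf|exact: Dg].
Qed.

End ContDiff.

(** * Mean value estimates, and level sets that meet a curve *)

Section LevelSets.
Context {R : realType}.

Lemma derivable_MVT (phi : R -> R) (a b : R) : a <= b ->
  (forall x, a <= x <= b -> derivable phi x 1) ->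
  exists2 c, a <= c <= b & phi b - phi a = 'D_1 phi c * (b - a).
Proof.
move=> ab dphi.
have [||c cab E] := @MVT_segment R phi ('D_1 phi) a b ab.
- move=> x; rewrite in_itv /= => /andP[ax xb].
  by apply: derivableP; apply: dphi; rewrite !ltW.
- by apply: derivable_within_continuous => x; rewrite in_itv /=; exact: dphi.
- by exists c => //; move: cab; rewrite in_itv.
Qed.

Lemma derivable_lipschitz (phi : R -> R) (I : set R) (K : R) :
  is_interval I -> (forall x, I x -> derivable phi x 1) ->
  (forall x, I x -> `|'D_1 phi x| <= K) ->
  forall a b, I a -> I b -> `|phi b - phi a| <= K * `|b - a|.
Proof.
move=> iI dphi K_phi a b; wlog ab : a b / a <= b => [hw Ia Ib|Ia Ib].
  have [/hw|/ltW/hw] := leP a b; first exact.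
  by rewrite [`|b - a|]distrC [`|phi b - _|]distrC; exact.
have Ix x : a <= x <= b -> I x by exact: iI.
have [x /Ix dx|c /Ix Ic ->] := @derivable_MVT phi a b ab; first exact: dphi.
by rewrite normrM ler_wpM2r// K_phi.
Qed.

Lemma derivable_0_cst (phi : R -> R) (I : set R) :
  is_interval I -> (forall x, I x -> derivable phi x 1) ->
  (forall x, I x -> 'D_1 phi x = 0) ->
  forall a b, I a -> I b -> phi a = phi b.
Proof.
move=> iI dphi phi0 a b Ia Ib; apply/esym/eqP; rewrite -subr_eq0 -normr_le0.
rewrite -[leRHS](mul0r `|b - a|); apply: (derivable_lipschitz iI) => //.
by move=> x /phi0 ->; rewrite normr0.
Qed.

(* The composite of a Lipschitz path with a function whose differential vanishes
   along the path has derivative 0, although the path need not be differentiable. *)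
Lemma dependent_cst_along_lipschitz (V : normedModType R) (f g : V -> R)
    (p : R -> V) (L : R) :
  (forall a b, `|p a - p b| <= L * `|a - b|) ->
  (forall a b, f (p a) = f (p b)) ->
  (forall a, [/\ differentiable f (p a), differentiable g (p a) &
     exists mu : R, forall v, 'd g (p a) v = mu * 'd f (p a) v]) ->
  forall a b, g (p a) = g (p b).
Proof.
move=> pL fp dfg x y; apply: (@is_derive_0_is_cst R (g \o p) x y) => {x y} a.
have [df dg [mu mudf]] := dfg a.
have L0 : 0 <= L.
  by have := pL 1 0; rewrite subr0 normr1 mulr1; exact: le_trans.
(* [k] has zero differential at [p a] and, as [f] is constant along [p], the same increments as [g]
   there. *)
pose k x := g x - mu * f x.
have [dk k0] : is_diff (p a) k (fun=> 0).
  have P := is_diffB (differentiableP dg) (is_diffZ mu (differentiableP df)).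
  by apply: (is_diff_eq P); apply/funext => v; rewrite !fctE mudf subrr.
have kE h : g (p (h + a)) - g (p a) = k (p (h + a)) - k (p a).
  by rewrite /k (fp (h + a) a) opprB addrA subrK.
suff: (fun h => h^-1 *: (g (p (h *: 1 + a)) - g (p a))) @ 0^' --> (0 : R).
  by move=> H; apply: DeriveDef; [apply/cvg_ex; exists (0 : R)|exact: cvg_lim H].
apply/cvgrPdist_le => e e0.
(* The denominator is [L + 1] because [L] may be 0. *)
have e1 : 0 < e / (L + 1) by rewrite divr_gt0// ltr_wpDl.
have /eqaddoP/(_ _ e1) := diff_locally dk; rewrite k0 => H.
have pc : (fun h => p (h + a) - p a) @ 0^' --> (0 : V).
  apply/cvgrPdist_le => r r0; near=> h.
  rewrite sub0r normrN (le_trans (pL _ _))// addrK.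
  have hr : `|h| <= r / (L + 1).
    by near: h; apply: dnbhs0_le; rewrite divr_gt0// ltr_wpDl.
  apply: le_trans (ler_wpM2l L0 hr) _.
  by rewrite mulrCA ler_piMr ?(ltW r0)// ler_pdivrMr ?mul1r ?lerDl// ltr_wpDl.
near=> h.
have h0 : h != 0 by near: h; exact: nbhs_dnbhs_neq.
have : `|k (p (h + a)) - k (p a)| <= e / (L + 1) * `|p (h + a) - p a|.
  have -> : k (p (h + a)) - k (p a) =
     (k \o shift (p a) - (cst (k (p a)) + fun=> 0)) (p (h + a) - p a).
    by rewrite !fctE /= subrK addr0.
  by near: h; exact: (pc _ H).
rewrite sub0r normrN [_ *: 1]mulr1 kE normrZ normfV => /le_trans H2.
rewrite ler_pdivrMl ?normr_gt0// mulrC; apply: H2.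
rewrite -mulrA ler_wpM2l ?(ltW e0)// ler_pdivrMl ?ltr_wpDl//.
apply: le_trans (pL _ _) _; rewrite addrK ler_wpM2r// lerDl//.
Unshelve. all: by end_near. Qed.

(** Extends a path on [[0, 1]] to the whole line, as [dependent_cst_along_lipschitz] requires,
    without spoiling its Lipschitz bound. *)
Let clamp (a : R) := Num.min 1 (Num.max 0 a).

Let clamp_itv a : 0 <= clamp a <= 1.
Proof. by rewrite /clamp le_min ge_min ler01 le_max !lexx. Qed.

Let clamp_lipschitz a b : `|clamp a - clamp b| <= `|a - b|.
Proof.
have := ler_norm (a - b); have := ler_norm (b - a); rewrite distrC => H1 H2.
rewrite ler_norml /clamp !minElt !maxElt.
by case: (ltP 0 a) => ?; case: (ltP 0 b) => ?; do 2![case: ltP => ?];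
  apply/andP; split; lra.
Qed.

(* Moving from [y] towards the curve while correcting along the curve so as to
   stay in a level set of [f]; the correction is only shown to be Lipschitz, which
   is enough by [dependent_cst_along_lipschitz] and avoids an implicit function
   theorem. *)
Lemma level_set_meets_curve (V : normedModType R) (f : V -> R) (c : R -> V)
    (t0 r d K C b : R) :
  0 < r -> 0 < d -> 0 < K -> 0 < C -> 0 < b ->
  (forall x, `|x - c t0| < r -> differentiable f x) ->
  (forall x v, `|x - c t0| < r -> `|'d f x v| <= K * `|v|) ->
  (forall t, `|t - t0| <= d -> differentiable c t) ->
  (forall s t, `|s - t0| <= d -> `|t - t0| <= d -> `|c s - c t| <= C * `|s - t|) ->
  (forall x t, `|x - c t0| < r -> `|t - t0| <= d -> b <= 'd f x ('D_1 c t)) ->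
  exists2 e, 0 < e & forall y, `|y - c t0| < e ->
    exists2 t, `|t - t0| <= d & forall g : V -> R,
      (forall x, `|x - c t0| < r -> differentiable g x /\
         exists mu : R, forall v, 'd g x v = mu * 'd f x v) ->
      g y = g (c t).
Proof.
move=> r0 d0 K0 C0 b0 df dfK dc cC dfb.
(* While [|s - t0| <= d1] the curve stays within [r / 2] of [c t0], which leaves [r / 2] for the
   displacement [eta] off the curve. *)
pose d1 := Num.min d (r / (2 * C)).
have d10 : 0 < d1 by rewrite lt_min d0 divr_gt0// mulr_gt0.
have d1d : d1 <= d by rewrite ge_min lexx.
have Cd1 : C * d1 <= r / 2.
  have -> : r / 2 = C * (r / (2 * C)) by field; rewrite gt_eqF.
  by rewrite ler_wpM2l ?(ltW C0)// ge_min lexx orbT.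
(* The second bound makes the change of [f] caused by [eta] smaller than [b * d1], the change
   guaranteed by moving [d1] along the curve. *)
exists (Num.min (r / 2) (b * d1 / K)).
  by rewrite lt_min !divr_gt0// mulr_gt0.
move=> y; rewrite lt_min => /andP[yr yb].
set eta := y - c t0 in yr yb *.
have Keta : K * `|eta| < b * d1 by rewrite mulrC -ltr_pdivlMr.
have inr (a s : R) : 0 <= a <= 1 -> `|s - t0| <= d1 -> `|(c s + a *: eta) - c t0| < r.
  move=> /andP[a0 a1] sd; rewrite addrAC (le_lt_trans (ler_normD _ _))//.
  rewrite [r]splitr ler_ltD//.
    apply: le_trans (cC _ _ (le_trans sd d1d) _) _.
      by rewrite subrr normr0 ltW.
    by apply: le_trans Cd1; rewrite ler_wpM2l// ltW.
  by rewrite normrZ ger0_norm// (le_lt_trans _ yr)// ler_piMl.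
(* [a] scales the displacement off the curve and [s] is the position along it; [F 1 t0] is [f y]. *)
pose F a s := f (c s + a *: eta).
have dF (a s : R) : 0 <= a <= 1 -> `|s - t0| <= d1 ->
    is_diff s (F a) (fun h => 'd f (c s + a *: eta) ('d c s h)).
  move=> a01 sd; have dcs := differentiableP (dc s (le_trans sd d1d)).
  have dfs := differentiableP (df _ (inr _ _ a01 sd)).
  have dce := is_diffD dcs (is_diff_cst (a *: eta) s); rewrite addr0 in dce.
  exact: (@is_diff_comp _ _ _ _ _ _ _ _ _ dce dfs).
have I1 : is_interval [set s | `|s - t0| <= d1].
  move=> u v /=; rewrite !ler_norml => /andP[? ?] /andP[? ?] w /andP[? ?].
  by rewrite /= ler_norml; apply/andP; split; lra.
have Fmono (a s s' : R) : 0 <= a <= 1 -> `|s - t0| <= d1 -> `|s' - t0| <= d1 ->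
    s' <= s -> b * (s - s') <= F a s - F a s'.
  move=> a01 sd sd' ss.
  have H x : s' <= x <= s -> `|x - t0| <= d1 by exact: (I1 s' s sd' sd x).
  have [|x /H xd ->] := @derivable_MVT (F a) s' s ss.
    by move=> x /H xd; apply: diff_derivable; have [] := dF a x a01 xd.
  rewrite ler_wpM2r ?subr_ge0//; have [dFx E] := dF a x a01 xd.
  rewrite deriveE// E -[X in 'd f _ X]deriveE.
    exact: dfb (inr _ _ a01 xd) (le_trans xd d1d).
  exact: dc (le_trans xd d1d).
(* Together with [Flip], this inverse estimate will show that the correction [s] depends on [a] in a
   Lipschitz way. *)
have Finj (a s s' : R) : 0 <= a <= 1 -> `|s - t0| <= d1 -> `|s' - t0| <= d1 ->
    b * `|s - s'| <= `|F a s - F a s'|.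
  move=> a01; wlog ss : s s' / s' <= s => [hw sd sd'|sd sd'].
    have [ss|/ltW ss] := leP s' s; first exact: hw.
    by rewrite distrC [`|F a s - _|]distrC; exact: hw.
  rewrite [`|s - _|]ger0_norm ?subr_ge0//.
  by apply: le_trans (Fmono a s s' a01 sd sd' ss) (ler_norm _).
have Flip (a a' s : R) : 0 <= a <= 1 -> 0 <= a' <= 1 -> `|s - t0| <= d1 ->
    `|F a s - F a' s| <= K * `|eta| * `|a - a'|.
  move=> a01 a01' sd.
  have I2 : is_interval [set x : R | 0 <= x <= 1].
    move=> u v /= /andP[? ?] /andP[? ?] w /andP[? ?] /=.
    by apply/andP; split; lra.
  have dG (x : R) : 0 <= x <= 1 -> is_diff x (fun x => F x s)
      (fun h => 'd f (c s + x *: eta) (h *: eta)).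
    move=> x01; have dfs := differentiableP (df _ (inr _ _ x01 sd)).
    have dce := is_diffD (is_diff_cst (c s) x) (is_diff_scalel x eta).
    rewrite add0r in dce.
    exact: (@is_diff_comp _ _ _ _ _ _ _ _ _ dce dfs).
  apply: (@derivable_lipschitz (fun x => F x s) _ _ I2) => //= x x01;
    have [dGx E] := dG x x01.
    exact: diff_derivable.
  by rewrite deriveE// E scale1r dfK// inr.
have a1 : 0 <= (1 : R) <= 1 by rewrite ler01 lexx.
have t0d : `|t0 - t0| <= d1 by rewrite subrr normr0 ltW.
have F1 : F 1 t0 = f y by rewrite /F scale1r addrC subrK.
(* The intermediate value theorem on [[t0 - d1, t0 + d1]] gives the correction; for [a] outside
   [[0, 1]] the value 0 is a dummy. *)
have tau (a : R) : {s | 0 <= a <= 1 -> `|s - t0| <= d1 /\ F a s = f y}.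
  apply: cid; have [a01|na] := boolP (0 <= a <= 1); last by exists 0.
  have Fa := Flip a 1 t0 a01 a1 t0d.
  have {}Fa : `|F a t0 - f y| <= b * d1.
    rewrite -F1; apply: (le_trans Fa); apply: le_trans (ltW Keta).
    rewrite ler_piMr ?mulr_ge0 ?(ltW K0)//.
    by move: a01 => /andP[? ?]; rewrite ler_norml; apply/andP; split; lra.
  have pd : `|t0 + d1 - t0| <= d1 by rewrite addrC addKr gtr0_norm.
  have md : `|t0 - d1 - t0| <= d1 by rewrite addrC addKr normrN gtr0_norm.
  have Fp := Fmono a _ _ a01 pd t0d; have Fm := Fmono a _ _ a01 t0d md.
  have [|||s sd Fs] := @IVT R (F a) (t0 - d1) (t0 + d1) (f y).
  - lra.
  - apply: derivable_within_continuous => x; rewrite in_itv /= => xd.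
    have {}xd : `|x - t0| <= d1 by rewrite ler_norml; lra.
    by apply: diff_derivable; have [] := dF a x a01 xd.
  - move: Fa Fp Fm; rewrite ler_norml => /andP[? ?].
    rewrite lerDl gerBl (ltW d10) => /(_ isT) Fp /(_ isT) Fm.
    rewrite ge_min le_max.
    by apply/andP; split; apply/orP; [left|right]; lra.
  - exists s => _; split => //; move: sd; rewrite in_itv /= ler_norml; lra.
pose T a := sval (tau a).
have TP (a : R) : 0 <= a <= 1 -> `|T a - t0| <= d1 /\ F a (T a) = f y.
  exact: svalP (tau a).
(* At [a = 1] the parameter [t0] already solves the equation, and [Finj] excludes any other
   choice. *)
have T1 : T 1 = t0.
  have [Td TF] := TP 1 a1; have := Finj 1 _ _ a1 Td t0d.
  rewrite TF F1 subrr normr0 pmulr_rle0// normr_le0 subr_eq0; exact: eqP.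
have a0 : 0 <= (0 : R) <= 1 by rewrite ler01 lexx.
have [T0d T0F] := TP 0 a0.
exists (T 0) => [|g dg]; first exact: le_trans d1d.
(* A Lipschitz path inside a level set of [f], from the curve point [c (T 0)] to [y]. *)
pose p a := c (T (clamp a)) + clamp a *: eta.
have p0 : p 0 = c (T 0).
  by rewrite /p /clamp maxxx min_r ?ler01// scale0r addr0.
have p1 : p 1 = y.
  by rewrite /p /clamp max_r ?ler01// minxx T1 scale1r addrC subrK.
rewrite -p0 -p1.
apply: (@dependent_cst_along_lipschitz V f g p ((C * (K * `|eta| / b)) + `|eta|)).
- move=> u v; have u01 := clamp_itv u; have v01 := clamp_itv v.
  have [ud uF] := TP _ u01; have [vd vF] := TP _ v01.
  rewrite /p opprD addrACA -scalerBl (le_trans (ler_normD _ _))// normrZ.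
  have Tuv : `|T (clamp u) - T (clamp v)| <= K * `|eta| / b * `|u - v|.
    rewrite mulrAC ler_pdivlMr// mulrC.
    apply: le_trans (Finj _ _ _ u01 ud vd) _; rewrite uF -vF.
    apply: le_trans (Flip _ _ _ v01 u01 vd) _; rewrite ler_wpM2l//.
      by rewrite mulr_ge0 ?(ltW K0).
    by rewrite distrC clamp_lipschitz.
  rewrite mulrDl lerD//.
    apply: le_trans (cC _ _ (le_trans ud d1d) (le_trans vd d1d)) _.
    by rewrite -mulrA ler_wpM2l// ltW.
  by rewrite mulrC ler_wpM2l// clamp_lipschitz.
- move=> u v.
  exact: etrans (TP _ (clamp_itv u)).2 (esym (TP _ (clamp_itv v)).2).
- move=> u; have u01 := clamp_itv u; have [ud _] := TP _ u01.
  by have [? ?] := dg _ (inr _ _ u01 ud); split => //; exact/df/inr.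
Qed.

End LevelSets.

(** * Estimates in coordinates, and the level-set lemma for [C^1] data *)

Section RowVectors.
Context {R : realType}.

Lemma ler_entry_norm (p q : nat) (A : 'M[R]_(p, q)) i j : `|A i j| <= `|A|.
Proof. by rewrite [leRHS]/Num.norm/= mx_normrE (le_bigmax _ _ (i, j)). Qed.

Lemma mx_norm_le (p q : nat) (A : 'M[R]_(p, q)) (e : R) : 0 <= e ->
  (forall i j, `|A i j| <= e) -> `|A| <= e.
Proof.
move=> e0 Ae; rewrite [leLHS]/Num.norm/= mx_normrE.
by apply: bigmax_le => // -[i j] _; exact: Ae.
Qed.

Lemma derive_entry (V : normedModType R) (p q : nat) (F : V -> 'M[R]_(p, q)) x v i j :
  differentiable F x -> 'D_v F x i j = 'D_v (fun y => F y i j) x.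
Proof. by move=> dF; rewrite derive_mx ?mxE//; exact: diff_derivable. Qed.

Lemma differentiable_entry (V : normedModType R) (p q : nat)
    (F : V -> 'M[R]_(p, q)) x i j :
  differentiable F x -> differentiable (fun y => F y i j) x.
Proof.
move=> dF; apply: (@differentiable_comp _ _ _ _ F (fun A => A i j)) => //.
exact: differentiable_coord.
Qed.

Lemma cvg_bigsum (T : Type) (F : set_system T) (FF : Filter F) (n : nat)
    (f : 'I_n -> T -> R) (l : 'I_n -> R) :
  (forall j, f j @ F --> l j) ->
  (fun x => \sum_j f j x) @ F --> \sum_j l j.
Proof.
elim: n f l => [|n IH] f l fl.
  have -> : (fun x => \sum_(j < 0) f j x) = cst 0.
    by apply/funext => x; rewrite big_ord0.
  by rewrite big_ord0; exact: cvg_cst.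
have -> : (fun x => \sum_(j < n.+1) f j x) =
    f ord0 + (fun x => \sum_(j < n) f (lift ord0 j) x).
  by apply/funext => x; rewrite big_ord_recl.
by rewrite big_ord_recl; apply: cvgD => //; apply: IH => j; exact: fl.
Qed.

Lemma near_norm_le (V W : normedModType R) (g : V -> W) (x0 : V) :
  {for x0, continuous g} -> \forall x \near x0, `|g x| <= 1 + `|g x0|.
Proof.
move=> cg; have H : `|g x| @[x --> x0] --> `|g x0| by exact: cvg_norm.
by apply: (cvgr_le _ H); rewrite ltrDr.
Qed.

Lemma nbhs_distP (V : normedModType R) (x : V) (P : set V) :
  nbhs x P <-> exists2 r, 0 < r & forall y, `|y - x| < r -> P y.
Proof.
rewrite -nbhs_nbhs_norm; split=> -[r /= r0 rP]; exists r => // y.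
  by rewrite distrC; exact: rP.
by rewrite /= distrC; exact: rP.
Qed.

(** Continuity of the first derivatives at the base point supplies all the constants that
    [level_set_meets_curve] asks for. *)
Lemma C1_level_set_meets_curve (p : nat) (f : 'rV[R]_p -> R) (c : R -> 'rV[R]_p)
    (t0 : R) (U : set 'rV[R]_p) (I : set R) :
  open U -> open I -> U (c t0) -> I t0 -> cont_diff 1 U f -> cont_diff 1 I c ->
  0 < 'd f (c t0) ('D_1 c t0) ->
  \forall y \near c t0, exists2 t, I t & forall g : 'rV[R]_p -> R,
    (forall x, U x -> differentiable g x /\
       exists mu : R, forall v, 'd g x v = mu * 'd f x v) ->
    g y = g (c t).
Proof.
move=> oU oI Uc It0 [df Df] [dc Dc] fc0.
move E : (c t0) Uc fc0 => x0 Ux0 fc0.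
(* Half of the positive derivative is a lower bound that survives nearby; the summands 1 in [K] and
   [C] leave room for the derivatives to vary. *)
pose b := 'd f x0 ('D_1 c t0) / 2.
pose K := 1 + \sum_j (1 + `|'D_(delta_mx 0 j) f x0|).
pose C := 1 + `|'D_1 c t0|.
have K0 : 0 < K by rewrite ltr_pwDl// sumr_ge0.
have nK : \forall x \near x0,
    forall j : 'I_p, `|'D_(delta_mx 0 j) f x| <= 1 + `|'D_(delta_mx 0 j) f x0|.
  apply: (@filter_forall _ _ _ _ (nbhs_filter x0)) => j /=.
  exact: (@near_norm_le _ _ ('D_(delta_mx 0 j) f) x0 (Df _ _ Ux0)).
have nC : \forall t \near t0, `|'D_1 c t| <= C.
  exact: (@near_norm_le _ _ ('D_1 c) t0 (Dc _ _ It0)).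
(* The pairing ['d f x ('D_1 c t)] in coordinates, where joint continuity at the base point follows
   from that of the partial derivatives. *)
pose S (z : 'rV[R]_p * R) :=
  \sum_j 'D_1 c z.2 0 j * 'D_(delta_mx 0 j) f z.1.
have cS : S @ (x0, t0) --> S (x0, t0).
  apply: cvg_bigsum => j /=; apply: cvgM.
    apply: (@cvg_comp _ _ _ snd (fun t => 'D_1 c t 0 j) _ (nbhs t0)).
      exact: cvg_snd.
    apply: (@cvg_comp _ _ _ ('D_1 c) (fun A : 'rV[R]_p => A 0 j) _
       (nbhs ('D_1 c t0))); first exact: (Dc 1 _ It0).
    exact: coord_continuous.
  apply: (@cvg_comp _ _ _ fst ('D_(delta_mx 0 j) f) _ (nbhs (x0))).
    exact: cvg_fst.
  exact: (Df (delta_mx 0 j) _ Ux0).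
have SE x t : U x -> 'd f x ('D_1 c t) = S (x, t).
  by move=> Ux; rewrite diff_rowE//; exact: df.
have bS : b < S (x0, t0).
  by rewrite -SE// /b ltr_pdivrMr// mulr_natr mulr2n ltrDl.
have bS' := cvgr_gt _ cS _ bS.
subst x0.
have [[A B] [nA nB] AB] := bS'.
have /nbhs_distP[r r0 Hr] := (@filterI _ _ (nbhs_filter _) _ _
  (near_open oU Ux0) (@filterI _ _ (nbhs_filter _) _ _ nK nA)).
have /nbhs_distP[d d0 Hd] := (@filterI _ _ (nbhs_filter _) _ _
  (near_open oI It0) (@filterI _ _ (nbhs_filter _) _ _ nC nB)).
(* Halving [d] turns the closed condition on [t] into the open one. *)
have ind t : `|t - t0| <= d / 2 -> `|t - t0| < d.
  move=> /le_lt_trans; apply.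
  by rewrite ltr_pdivrMr// mulr_natr mulr2n ltrDl.
have C0 : 0 < C by rewrite ltr_wpDr.
have b0 : 0 < b by rewrite divr_gt0.
have d20 : 0 < d / 2 by rewrite divr_gt0.
have iI : is_interval [set t | `|t - t0| <= d / 2].
  move=> u v /=; rewrite !ler_norml => /andP[? ?] /andP[? ?] w /andP[? ?].
  by rewrite /= ler_norml; apply/andP; split; lra.
have := @level_set_meets_curve R _ f c t0 r (d / 2) K C b r0 d20 K0 C0 b0.
case=> [x /Hr[Ux _]|x v /Hr[Ux [Kx _]]|t /ind/Hd[It _]|s t sd td|
    x t /Hr[Ux [_ Ax]] /ind/Hd[_ [_ Bt]]|e e0 He].
- exact: df.
- rewrite diff_rowE; last exact: df.
  apply: (le_trans (ler_norm_sum _ _ _)).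
  rewrite /K mulrDl mul1r ler_wpDl// mulr_suml ler_sum// => j _.
  by rewrite normrM mulrC ler_pM// ler_entry_norm.
- exact: dc.
- apply: mx_norm_le => [|i j]; first by rewrite mulr_ge0// ltW.
  rewrite !mxE; apply: (@derivable_lipschitz R (fun t => c t i j) _ C iI) => //=.
    move=> x /ind/Hd[Ix _]; apply: diff_derivable; apply: differentiable_entry.
    exact: dc.
  move=> x /ind/Hd[Ix [Cx _]]; rewrite -derive_entry; last exact: dc.
  exact: le_trans (ler_entry_norm _ _ _) Cx.
- by rewrite SE// ltW//; apply: AB.
apply/nbhs_distP; exists e => // y /He[t td gt].
exists t; first by have [] := Hd _ (ind _ td).
by move=> g dg; apply: gt => x /Hr[Ux _]; exact: dg.
Qed.

End RowVectors.

(** * Derivatives of matrix-valued maps *)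

Section MatrixCalculus.
Context {R : realType} {V : normedModType R}.

Lemma differentiable_mxP (p q : nat) (F : V -> 'M[R]_(p, q)) x :
  differentiable F x <-> forall i j, differentiable (fun y => F y i j) x.
Proof.
split=> [dF i j|dF]; first exact: differentiable_entry.
have -> : F = \sum_i \sum_j (fun y => F y i j *: delta_mx i j).
  apply/funext => y; rewrite fct_sumE [LHS]matrix_sum_delta.
  by apply: eq_bigr => i _; rewrite fct_sumE.
apply: differentiable_sum => i; apply: differentiable_sum => j.
by apply: differentiable_scale.
Qed.

Lemma derive_trmx (p q : nat) (F : V -> 'M[R]_(p, q)) x v :
  differentiable F x -> 'D_v (fun y => (F y)^T) x = ('D_v F x)^T.
Proof.
move=> dF; have dFT : differentiable (fun y => (F y)^T) x.
  apply/differentiable_mxP => i j.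
  under eq_fun do rewrite mxE.
  exact: differentiable_entry.
apply/matrixP => i j; rewrite mxE !derive_entry//.
by under eq_fun do rewrite mxE.
Qed.

Lemma differentiable_mulmx (p q r : nat) (F : V -> 'M[R]_(p, q))
    (G : V -> 'M[R]_(q, r)) x :
  differentiable F x -> differentiable G x ->
  differentiable (fun y => F y *m G y) x.
Proof.
move=> dF dG; apply/differentiable_mxP => i j.
have -> : (fun y => (F y *m G y) i j) = \sum_l (fun y => F y i l * G y l j).
  by apply/funext => y; rewrite fct_sumE mxE.
apply: differentiable_sum => l.
by apply: differentiableM; exact: differentiable_entry.
Qed.

Lemma derive_mulmx (p q r : nat) (F : V -> 'M[R]_(p, q))
    (G : V -> 'M[R]_(q, r)) x v :
  differentiable F x -> differentiable G x ->
  'D_v (fun y => F y *m G y) x = 'D_v F x *m G x + F x *m 'D_v G x.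
Proof.
move=> dF dG; apply/matrixP => i j.
rewrite derive_entry; last exact: differentiable_mulmx.
have -> : (fun y => (F y *m G y) i j) = \sum_l (fun y => F y i l * G y l j).
  by apply/funext => y; rewrite fct_sumE mxE.
have dFil l : derivable (fun y => F y i l) x v.
  exact/diff_derivable/differentiable_entry.
have dGlj l : derivable (fun y => G y l j) x v.
  exact/diff_derivable/differentiable_entry.
rewrite derive_sum => [|l]; last exact: derivableM.
rewrite !mxE -big_split; apply: eq_bigr => l _ /=.
by rewrite deriveM// !derive_entry// addrC; congr (_ + _); exact: mulrC.
Qed.

End MatrixCalculus.

(** * Orthogonal complements and projections *)

Section Orthogonality.
Context {R : realType} {N : nat}.

Lemma dotmx_eq0 (v : 'rV[R]_N) : v *m v^T = 0 -> v = 0.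
Proof.
move=> /matrixP/(_ 0 0); rewrite !mxE => /eqP.
rewrite psumr_eq0 => [/allP v0|i _]; last by rewrite mxE -expr2 sqr_ge0.
apply/rowP => i; have := v0 i (mem_index_enum _).
by rewrite !mxE mulf_eq0 orbb => /eqP.
Qed.

Lemma orth_complP (D : 'M[R]_N) (v : 'rV[R]_N) :
  reflect (forall u : 'rV[R]_N, (u <= D)%MS -> v *m u^T = 0)
    (v <= orth_compl D)%MS.
Proof.
apply: (iffP sub_kermxP) => [vD u /submxP[a ->]|vD].
  by rewrite trmx_mul mulmxA vD mul0mx.
apply/rowP => i; have := vD (row i D) (row_sub i D).
move=> /matrixP/(_ 0 0); rewrite !mxE => H; rewrite -[RHS]H.
by apply: eq_bigr => j _; rewrite !mxE.
Qed.

(** Positivity of the scalar product makes the intersection of [D] with its complement trivial; a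
    rank count then shows that their sum is the whole space. *)
Lemma proj_top_perp (D : 'M[R]_N) (v : 'rV[R]_N) :
  [/\ (proj_top D v <= D)%MS, (proj_perp D v <= orth_compl D)%MS &
      proj_top D v + proj_perp D v = v].
Proof.
have cap0 : (D :&: orth_compl D)%MS = 0.
  apply/eqP/rowV0P => u; rewrite sub_capmx => /andP[uD /orth_complP uDp].
  exact/dotmx_eq0/uDp.
have sum1 : (v <= D + orth_compl D)%MS.
  apply: submx_full; rewrite /row_full eqn_leq rank_leq_col.
  have := mxrank_sum_cap D (orth_compl D); rewrite cap0 mxrank0 addn0 => ->.
  by rewrite /orth_compl mxrank_ker mxrank_tr /= subnKC ?rank_leq_row.
by split; [exact: proj_mx_sub|exact: proj_mx_sub|exact: add_proj_mx].
Qed.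

End Orthogonality.

(** * The span of the normals other than [N s] is constant *)

Section ParallelNormals.
Context {R : realType} {m n : nat}.
Variables (I : set R) (D : R -> 'M[R]_(m + n)) (N : 'I_n -> R -> 'rV[R]_(m + n)).
Variable s : 'I_n.
Hypothesis (hI : is_interval I) (Iopen : open I).
Hypothesis hN : smooth_orthonormal_normal_frame I D N.
Hypothesis htop : forall k, k != s ->
  forall t, I t -> proj_top (D t) (derive1 (N k) t) = 0.
Hypothesis hperp : forall t, I t -> proj_perp (D t) (derive1 (N s) t) = 0.

Definition other_normals t : 'M[R]_(n.-1, m + n) :=
  \matrix_(k < n.-1) N (lift s k) t.

Let F t : 'M[R]_(n, m + n) := \matrix_(k < n) N k t.

Let dN k t : I t -> differentiable (N k) t.
Proof. by move=> It; have [/(_ k 1)[dNk _] _] := hN; exact: dNk. Qed.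

Let dW t : I t -> differentiable other_normals t.
Proof.
move=> It; apply/differentiable_mxP => i j.
rewrite (_ : (fun y => _) = fun y => N (lift s i) y 0 j).
  exact/differentiable_entry/dN.
by apply/funext => y; rewrite mxE.
Qed.

Let row_dW k t : I t -> row k ('D_1 other_normals t) = 'D_1 (N (lift s k)) t.
Proof.
move=> It; apply/rowP => j; rewrite mxE !derive_entry//; [|exact: dN|exact: dW].
by congr ('D_1 _ t); apply/funext => y; rewrite mxE.
Qed.

Lemma normal_perp t k (v : 'rV[R]_(m + n)) : I t -> (v <= D t)%MS ->
  N k t *m v^T = 0.
Proof.
move=> It; apply/orth_complP; have [_ /(_ t It)[_ /andP[FD _]]] := hN.
by apply: submx_trans FD; rewrite -[N k t](rowK (fun k => N k t)) row_sub.
Qed.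

Let normal_dot t k l : I t -> N k t *m (N l t)^T = (k == l)%:R%:M.
Proof.
move=> It; have [_ /(_ t It)[/matrixP/(_ k l) + _]] := hN.
rewrite !mxE => FF; apply/matrixP => i j; rewrite !ord1 !mxE mulr1n -FF.
by apply: eq_bigr => x _; rewrite !mxE.
Qed.

Lemma other_normals_orthonormal t : I t ->
  other_normals t *m (other_normals t)^T = 1%:M.
Proof.
move=> It; apply/matrixP => k l.
have := normal_dot (lift s k) (lift s l) It.
move=> /matrixP/(_ 0 0); rewrite !mxE mulr1n (inj_eq (@lift_inj _ s)) => <-.
by apply: eq_bigr => x _; rewrite !mxE.
Qed.

Let dNs_tangent t : I t -> ('D_1 (N s) t <= D t)%MS.
Proof.
move=> It; have [sub _ E] := proj_top_perp (D t) ('D_1 (N s) t).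
by rewrite -E -derive1E hperp// addr0 derive1E.
Qed.

Let dN_normal t k : I t -> k != s -> ('D_1 (N k) t <= orth_compl (D t))%MS.
Proof.
move=> It ks; have [_ sub E] := proj_top_perp (D t) ('D_1 (N k) t).
by rewrite -E -derive1E htop// add0r derive1E.
Qed.

(** Differentiating the orthogonality of [N k] and [N s] moves the derivative onto [N s], and the
    derivative of [N s] is tangent. *)
Let perp_dN t k : I t -> k != s -> 'D_1 (N k) t *m (N s t)^T = 0.
Proof.
move=> It ks.
have : 'D_1 (fun y => N k y *m (N s y)^T) t = 0.
  rewrite -(derive_cst (0 : 'M[R]_1) t 1); apply: near_eq_derive.
  apply: filterS (near_open Iopen It) => y Iy.
  by rewrite normal_dot// (negbTE ks) raddf0.
have dT : differentiable (fun y => (N s y)^T) t.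
  by apply/differentiable_mxP => i j; under eq_fun do rewrite mxE;
    exact/differentiable_entry/dN.
rewrite derive_mulmx ?derive_trmx//; try exact: dN.
by rewrite normal_perp ?addr0//; exact: dNs_tangent.
Qed.

Let frame_gram t : (F t)^T *m F t =
  (N s t)^T *m N s t + (other_normals t)^T *m other_normals t.
Proof.
apply/matrixP => i j; rewrite !mxE (bigD1_ord s)//= !mxE big_ord1 !mxE.
by congr (_ + _); apply: eq_bigr => k _; rewrite !mxE.
Qed.

(** For [k != s] the derivative of [N k] is normal and orthogonal to [N s], so its expansion in the
    orthonormal frame involves only the rows of [other_normals]. *)
Let dW_span t : I t -> 'D_1 other_normals t =
  'D_1 other_normals t *m (other_normals t)^T *m other_normals t.
Proof.
move=> It; apply/row_matrixP => k; rewrite !row_mul row_dW//.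
set v := 'D_1 _ t; have ks : lift s k != s by rewrite eq_sym neq_lift.
have [_ /(_ t It)[FF /andP[_ DF]]] := hN.
have /submxP[a va] := submx_trans (dN_normal It ks) DF.
have : v = v *m (F t)^T *m F t by rewrite /v va -(mulmxA a) FF mulmx1.
by rewrite -mulmxA frame_gram mulmxDr !mulmxA perp_dN// mul0mx add0r.
Qed.

(* The subspace spanned by the [N k], [k != s], is invariant under differentiation,
   so the orthogonal projection onto it, whose matrix is W^T W, is constant. *)
Let gram_cst t t' : I t -> I t' ->
  (other_normals t)^T *m other_normals t =
  (other_normals t')^T *m other_normals t'.
Proof.
move=> It It'; apply/matrixP => i j.
have dT y : I y -> differentiable (fun y => (other_normals y)^T) y.
  move=> Iy; apply/differentiable_mxP => a b; under eq_fun do rewrite mxE.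
  exact/differentiable_entry/dW.
have dQ y : I y ->
    differentiable (fun y => (other_normals y)^T *m other_normals y) y.
  by move=> Iy; apply: differentiable_mulmx; [exact: dT|exact: dW].
apply: (@derivable_0_cst R
  (fun y => ((other_normals y)^T *m other_normals y) i j) I hI) => // y Iy.
  by apply: diff_derivable; exact/differentiable_entry/dQ.
rewrite -derive_entry; last exact: dQ.
suff -> : 'D_1 (fun y => (other_normals y)^T *m other_normals y) y = 0.
  by rewrite mxE.
rewrite derive_mulmx ?derive_trmx//; [|exact: dW|exact: dT|exact: dW].
have : 'D_1 (fun y => other_normals y *m (other_normals y)^T) y = 0.
  rewrite -(derive_cst (1%:M : 'M[R]_(n.-1)) y 1); apply: near_eq_derive.
  by apply: filterS (near_open Iopen Iy) => z /other_normals_orthonormal.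
rewrite derive_mulmx ?derive_trmx//; [|exact: dW|exact: dW|exact: dT].
move: (other_normals y) ('D_1 other_normals y) (dW_span Iy) => W W' W'E skew.
(* [skew] states [W' W^T + W W'^T = 0]. Substituting [W' = (W' W^T) W] and its transpose turns the
   derivative of [W^T W] into [W^T (W W'^T + W' W^T) W]. *)
have W'T : W'^T = W^T *m (W *m W'^T) by rewrite {1}W'E !trmx_mul trmxK.
rewrite W'T [in X in _ + X]W'E [X in _ + X]mulmxA -mulmxDl -mulmxDr addrC skew.
by rewrite mulmx0 mul0mx.
Qed.

(** Since [W W^T = 1] at [t0], [v W^T] equals [v (W^T W) W^T], and the constant matrix [W^T W] may
    be taken at [t], where [v W^T = 0]. *)
Lemma other_normals_perp t0 t (v : 'rV[R]_(m + n)) : I t0 -> I t ->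
  (v <= D t)%MS -> v *m (other_normals t0)^T = 0.
Proof.
move=> It0 It vD.
have vW : v *m (other_normals t)^T = 0.
  apply/rowP => k; have := normal_perp (lift s k) It vD.
  move=> /matrixP/(_ 0 0); rewrite !mxE => H; rewrite -[RHS]H.
  by apply: eq_bigr => j _; rewrite !mxE mulrC.
rewrite -[LHS]mulmx1 -(other_normals_orthonormal It0) mulmxA -(mulmxA v).
by rewrite (gram_cst It0 It) mulmxA vW !mul0mx.
Qed.

End ParallelNormals.

(** * Smoothness of determinants and inverse matrices *)

Section MoreContDiff.
Context {R : realType}.

Lemma open_setI_preimage (V W : normedModType R) (U : set V) (f : V -> W)
    (O : set W) :
  open U -> open O -> (forall x, U x -> {for x, continuous f}) ->
  open [set x | U x /\ O (f x)].
Proof.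
move=> oU oO cf; rewrite openE => x [Ux Ofx].
have H : \forall y \near x, O (f y) by apply: (cf x Ux); exact: open_nbhs_nbhs.
exact: (filterI (near_open oU Ux) H).
Qed.

Lemma cont_diff_mulmx (V : normedModType R) k (U : set V) (p q r : nat)
    (F : V -> 'M[R]_(p, q)) (G : V -> 'M[R]_(q, r)) :
  open U -> cont_diff k U F -> cont_diff k U G ->
  cont_diff k U (fun x => F x *m G x).
Proof.
move=> oU /(cont_diff_mxP _ _ oU) CF /(cont_diff_mxP _ _ oU) CG.
apply/cont_diff_mxP => // i j.
apply: (@eq_cont_diff _ _ _ _ _ (fun x => \sum_l F x i l * G x l j)) => //.
  by move=> x _; rewrite mxE.
by apply: cont_diff_sum => // l _; exact: cont_diffM.
Qed.

Lemma cont_diff_det (V : normedModType R) k (U : set V) (p : nat)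
    (F : V -> 'M[R]_p) :
  open U -> (forall i j, cont_diff k U (fun x => F x i j)) ->
  cont_diff k U (fun x => \det (F x)).
Proof.
move=> oU CF; apply: cont_diff_sum => // sigma _.
by apply: cont_diffM => //; [exact: cont_diff_cst|exact: cont_diff_prod].
Qed.

(** Cramer's formula expresses the inverse through polynomials in the entries and the inverse of the
    determinant. *)
Lemma cont_diff_invmx (V : normedModType R) k (U : set V) (p : nat)
    (F : V -> 'M[R]_p) :
  open U -> (forall x, U x -> F x \in unitmx) -> cont_diff k U F ->
  cont_diff k U (fun x => invmx (F x)).
Proof.
move=> oU Fu /(cont_diff_mxP _ _ oU) CF.
apply: (@eq_cont_diff _ _ _ _ _ (fun x => (\det (F x))^-1 *: \adj (F x))) => //.
  by move=> x /Fu Fx; rewrite /invmx Fx.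
apply: cont_diff_scale => //.
  apply: cont_diffV => //; last exact: cont_diff_det.
  by move=> x /Fu; rewrite unitmxE unitfE.
apply/cont_diff_mxP => // i j.
apply: (@eq_cont_diff _ _ _ _ _ (fun x => cofactor (F x) j i)) => //.
  by move=> x _; rewrite mxE.
apply: cont_diffM => //; first exact: cont_diff_cst.
apply: cont_diff_det => // a b.
apply: (@eq_cont_diff _ _ _ _ _ (fun x => F x (lift j a) (lift i b))) => //.
by move=> x _; rewrite !mxE.
Qed.

End MoreContDiff.

(** * Slice charts: tangent and nullity spaces in coordinates *)

Section Chart.
Context {R : realType} {m n : nat}.
Variables (M U V : set 'rV[R]_(m + n)).
Variables (f g : 'rV[R]_(m + n) -> 'rV[R]_(m + n)).
Hypothesis (oU : open U) (oV : open V).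
Hypothesis (sf : smooth U f) (sg : smooth V g).
Hypothesis gf : forall q, U q -> V (f q) /\ g (f q) = q.
Hypothesis fg : forall w, V w -> U (g w) /\ f (g w) = w.
Hypothesis slice : forall q, U q -> (M q <-> rsubmx (f q) = 0).

Let iota (u : 'rV[R]_m) : 'rV[R]_(m + n) := row_mx u 0.

Definition chart_param (u : 'rV[R]_m) : 'rV[R]_(m + n) := g (iota u).

Definition chart_dom : set 'rV[R]_m := [set u | V (iota u)].

(** With partial derivatives as rows, the differential is [v *m J u] and the tangent space is the
    row space. *)
Definition chart_jac (u : 'rV[R]_m) : 'M[R]_(m, m + n) :=
  \matrix_(i, j) 'D_(delta_mx 0 i) chart_param u 0 j.

Local Notation psi := chart_param.
Local Notation J := chart_jac.

Let iotaE : iota = fun u => id u *m row_mx 1%:M 0.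
Proof. by apply/funext => u; rewrite mul_mx_row mulmx1 mulmx0. Qed.

Let smooth_iota : smooth setT iota.
Proof.
move=> k; rewrite iotaE.
apply: cont_diff_mulmx; [exact: openT|exact: cont_diff_id|exact: cont_diff_cst].
Qed.

Let derive_iota u w : 'D_w iota u = iota w.
Proof.
rewrite {1}iotaE (derive_mulmx _ (F := id) (G := cst _))//.
by rewrite derive_cst mulmx0 addr0 derive_id iotaE.
Qed.

Lemma open_chart_dom : open chart_dom.
Proof.
apply: (@open_comp _ _ iota) => // u _.
by have := cont_diff_continuous (smooth_iota 0); exact.
Qed.

Lemma smooth_chart_param : smooth chart_dom psi.
Proof.
move=> k; apply: (@cont_diff_comp _ _ _ _ _ _ V iota g) => //.
  exact: open_chart_dom.
exact: cont_diff_sub (smooth_iota k).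
Qed.

Lemma differentiable_chart_param u : chart_dom u -> differentiable psi u.
Proof. by move: u; have [] := smooth_chart_param 1. Qed.

Lemma smooth_chart_jac : smooth chart_dom J.
Proof.
move=> k; apply/cont_diff_mxP; first exact: open_chart_dom.
move=> i j; apply: (@eq_cont_diff _ _ _ _ _
  (fun u => 'D_(delta_mx 0 i) psi u 0 j)); first exact: open_chart_dom.
  by move=> u _; rewrite mxE.
have [_ /(_ (delta_mx 0 i))/cont_diff_mxP] := smooth_chart_param k.+1.
by apply; exact: open_chart_dom.
Qed.

Lemma differentiable_chart_jac u : chart_dom u -> differentiable J u.
Proof. by move: u; have [] := smooth_chart_jac 1. Qed.

Lemma derive_chart_param u v : chart_dom u -> 'D_v psi u = v *m J u.
Proof.
move=> Vu; have du := differentiable_chart_param Vu.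
rewrite deriveE// diff_rowE//; apply/rowP => j; rewrite summxE mxE.
by apply: eq_bigr => i _; rewrite !mxE.
Qed.

Lemma derive2_chart_param u v w : chart_dom u ->
  'D_v ('D_w psi) u = w *m 'D_v J u.
Proof.
move=> Vu; transitivity ('D_v (fun y => w *m J y) u).
  apply: near_eq_derive; apply: filterS (near_open open_chart_dom Vu) => y.
  exact: derive_chart_param.
rewrite (derive_mulmx _ (F := cst w)); [|by []|exact: differentiable_chart_jac].
by rewrite derive_cst mul0mx add0r.
Qed.

Lemma chart_param_mem u : chart_dom u -> U (psi u) /\ M (psi u).
Proof.
move=> Vu; have [Ug Eg] := fg Vu; split=> //.
by apply/(slice Ug); rewrite Eg row_mxKr.
Qed.

Lemma chart_coord q : U q -> M q ->
  chart_dom (lsubmx (f q)) /\ psi (lsubmx (f q)) = q.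
Proof.
move=> Uq /(slice Uq) fq0; have [Vq gq] := gf Uq.
have E : iota (lsubmx (f q)) = f q by rewrite /iota -fq0 hsubmxK.
by rewrite /chart_dom /= /chart_param E.
Qed.

Lemma chart_coordK u : chart_dom u -> lsubmx (f (psi u)) = u.
Proof. by move=> /fg[_ E]; rewrite E row_mxKl. Qed.

Lemma differentiable_chart_coord q : U q ->
  differentiable (fun q => lsubmx (f q)) q.
Proof.
move=> Uq; apply: (@differentiable_comp _ _ _ _ f lsubmx).
  by have [df _] := sf 1; exact: df.
exact: differentiable_lsubmx.
Qed.

(** Near [t] the curve is the parametrization applied to its own coordinates, because it stays in
    [M] at all nearby times; the chain rule then applies. *)
Lemma derive_chart_curve (c : R -> 'rV[R]_(m + n)) t :
  differentiable c t -> U (c t) -> (\forall t' \near t, M (c t')) ->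
  'D_1 c t = 'D_1 (fun t => lsubmx (f (c t))) t *m J (lsubmx (f (c t))).
Proof.
move=> dc Uc Mc; pose b t := lsubmx (f (c t)).
have db : differentiable b t.
  apply: (@differentiable_comp _ _ _ _ c (fun q => lsubmx (f q))) => //.
  exact: differentiable_chart_coord.
have [Vb _] := chart_coord Uc (nbhs_singleton Mc).
transitivity ('D_1 (psi \o b) t).
  apply: near_eq_derive.
  have Ut : \forall t' \near t, U (c t').
    by apply: (differentiable_continuous dc); exact: open_nbhs_nbhs.
  apply: filterS2 Ut Mc => t' Ut' Mt'.
  by have [_] := chart_coord Ut' Mt'.
have dp := differentiable_chart_param Vb.
rewrite deriveE; last exact: differentiable_comp.
by rewrite diff_comp//= -deriveE// derive_chart_param// deriveE.
Qed.

Lemma tangent_space_chart u : chart_dom u ->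
  tangent_space M (psi u) = [set v | (v <= J u)%MS].
Proof.
move=> Vu; have [Uu Mu] := chart_param_mem Vu.
apply/seteqP; split=> v /=.
  move=> [c [e [e0 sc Mc c0 <-]]].
  have dc : differentiable c 0.
    by have [dc _] := sc 1; apply: dc; rewrite /= in_itv /= oppr_lt0 e0.
  rewrite derive1E derive_chart_curve ?c0// ?chart_coordK// ?submxMl//.
  apply/nbhs_distP; exists e => // t; rewrite subr0 ltr_norml => te.
  by apply: Mc; rewrite in_itv.
move=> /submxP[a ->].
(* The vector [a *m J u] is the initial velocity of the image under [psi] of the line through [u] in
   the direction [a]. *)
pose l (t : R) : 'rV[R]_m := u + t *: a.
have sl k (S : set R) : open S -> cont_diff k S l.
  move=> oS; apply: cont_diffD => //; first exact: cont_diff_cst.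
  by apply: cont_diff_scale => //; [exact: cont_diff_id|exact: cont_diff_cst].
have l0 : l 0 = u by rewrite /l scale0r addr0.
have : \forall t \near 0, chart_dom (l t).
  have cl := cont_diff_continuous (sl 0%N setT openT) (I : setT 0).
  by apply: cl; rewrite l0; exact: (open_nbhs_nbhs (conj open_chart_dom Vu)).
move=> /nbhs_distP[e e0 Ve].
have Vl t : t \in `]- e, e[ -> chart_dom (l t).
  by rewrite in_itv => te; apply: Ve; rewrite subr0 ltr_norml.
have oe : open [set` `]- e, e[] by exact: interval_open.
exists (psi \o l), e; split=> //=.
- move=> k; apply: (@cont_diff_comp _ _ _ _ _ _ chart_dom l psi) => //.
    exact: sl.
  exact: smooth_chart_param.
- by move=> t /Vl/chart_param_mem[].
- by rewrite l0.
have dl : is_diff (0 : R) l (fun t => t *: a).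
  have := is_diffD (is_diff_cst u (0 : R)) (is_diff_scalel 0 a).
  by rewrite add0r.
have dp := differentiable_chart_param Vu.
have dpl : differentiable psi (l 0) by rewrite l0.
rewrite derive1E deriveE; last exact: differentiable_comp.
by rewrite diff_comp//= l0 diff_val scale1r -deriveE// derive_chart_param.
Qed.

(* The fields [Y = 'D_w g \o f] with [w] parallel to the slice are tangent to M
   and witness the second fundamental form in the coordinate directions. *)
Lemma nullity_space_chart u x : chart_dom u -> nullity_space M (psi u) x ->
  exists2 a : 'rV[R]_m, x = a *m J u & ('D_a J u <= J u)%MS.
Proof.
move=> Vu [Tx Nx]; have [Uu Mu] := chart_param_mem Vu.
move: Tx; rewrite tangent_space_chart// => /submxP[a xa]; exists a => //.
apply/row_subP => i; pose w : 'rV[R]_m := delta_mx 0 i.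
pose Y q := 'D_(iota w) g (f q).
have sY : smooth U Y.
  move=> k; apply: (@cont_diff_comp _ _ _ _ _ _ V f ('D_(iota w) g)) => //.
    by move=> q /gf[].
  by have [_] := sg k.+1; exact.
have Ypsi y : chart_dom y -> Y (psi y) = 'D_w psi y.
  move=> Vy; rewrite /Y (fg Vy).2.
  have [diota _] := smooth_iota 1; have [dg _] := sg 1.
  rewrite [RHS]deriveE; last exact: differentiable_chart_param.
  rewrite (@diff_comp _ _ _ _ iota g); [|exact: diota|exact: dg].
  rewrite deriveE; last exact: dg.
  by rewrite /= -[X in _ = 'd g _ X]deriveE; [rewrite derive_iota|exact: diota].
have YpsiJ y : chart_dom y -> (Y (psi y) <= J y)%MS.
  by move=> Vy; rewrite Ypsi// derive_chart_param// submxMl.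
have YM q : U q -> M q -> tangent_space M q (Y q).
  move=> Uq Mq; have [Vy <-] := chart_coord Uq Mq.
  by rewrite tangent_space_chart//; exact: YpsiJ.
(* The projections take square matrices, hence the generated matrix [T] in place of [J u]. *)
pose T := <<J u>>%MS.
have [topT perpT E] := proj_top_perp T ('D_x Y (psi u)).
set z := proj_perp T _ in perpT E.
(* [z] is the second fundamental form of [x] and [Y (psi u)], which is zero by nullity of [x]. *)
have z0 : z = 0.
  apply: (Nx (Y (psi u))); first exact: YM.
  exists U, Y; split => //.
  rewrite /normal_to tangent_space_chart//; split=> [|v vJ].
    by rewrite /= -E addrK -(genmxE (J u)).
  by move/orth_complP : perpT; apply; rewrite genmxE.
have dY : differentiable Y (psi u) by have [dY _] := sY 1; exact: dY.
have dp := differentiable_chart_param Vu.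
have : ('D_x Y (psi u) <= J u)%MS by rewrite -E z0 addr0 -(genmxE (J u)).
(* By the chain rule, the derivative of [Y] along [x = a *m J u] is a second derivative of [psi],
   namely row [i] of ['D_a J u]. *)
suff -> : 'D_x Y (psi u) = 'D_a ('D_w psi) u by rewrite derive2_chart_param// rowE.
transitivity ('D_a (Y \o psi) u); last first.
  apply: near_eq_derive; apply: filterS (near_open open_chart_dom Vu) => y.
  exact: Ypsi.
rewrite [RHS]deriveE; last exact: differentiable_comp.
by rewrite diff_comp//= -[X in 'd Y _ X]deriveE// derive_chart_param// -xa deriveE.
Qed.

Lemma rank_one_chart u : rank_one_submanifold M -> chart_dom u ->
  exists X : 'M[R]_(m + n, m), (m - 1 <= \rank X)%N /\
    forall i, ('D_(row i X) J u <= J u)%MS.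
Proof.
move=> [_ r1] Vu; have [_ /r1[A [rA NA]]] := chart_param_mem Vu.
have rowA i : exists a, row i A = a *m J u /\ ('D_a J u <= J u)%MS.
  have : nullity_space M (psi u) (row i A) by rewrite NA /= row_sub.
  by case/(nullity_space_chart Vu) => a; exists a.
have /choice[a aP] := rowA.
exists (\matrix_i a i); split=> [|i]; last by rewrite rowK; have [] := aP i.
rewrite -rA (_ : A = \matrix_i a i *m J u) ?mxrankM_maxl//.
by apply/row_matrixP => i; rewrite row_mul rowK; have [] := aP i.
Qed.

End Chart.

(** * The normalized Gauss map of a rank-one Jacobian *)

Section RankOneJacobian.
Context {R : realType}.

(** By rank-nullity the kernel is at most a line, so the nonzero [a] spans it. The vectors in
    question will be gradients annihilated by the nullity directions. *)
Lemma corank1_kernel_colinear (p m : nat) (X : 'M[R]_(p, m)) (a b : 'cV[R]_m) :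
  (m - 1 <= \rank X)%N -> X *m a = 0 -> X *m b = 0 -> a != 0 ->
  exists mu : R, b = mu *: a.
Proof.
move=> rX Xa Xb a0.
have ker (c : 'cV[R]_m) : X *m c = 0 -> (c^T <= kermx X^T)%MS.
  by move=> Xc; apply/sub_kermxP; rewrite -trmx_mul Xc trmx0.
have aT0 : a^T != 0 by rewrite trmx_eq0.
have kera : (kermx X^T <= a^T)%MS.
  rewrite -(geq_leqif (mxrank_leqif_sup (ker a Xa))) mxrank_ker mxrank_tr.
  by rewrite rank_rV aT0 leq_subLR addnC -leq_subLR.
have /sub_rVP[mu bE] := submx_trans (ker b Xb) kera.
by exists mu; rewrite -[b]trmxK bE linearZ/= trmxK.
Qed.

Let grad (m : nat) (h : 'rV[R]_m -> R) u : 'cV[R]_m :=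
  \col_i 'D_(delta_mx 0 i) h u.

Let diff_grad (m : nat) (h : 'rV[R]_m -> R) u v : differentiable h u ->
  'd h u v = (v *m grad h u) 0 0.
Proof.
by move=> dh; rewrite diff_rowE// mxE; apply: eq_bigr => i _; rewrite mxE.
Qed.

Variables (m N : nat) (dom : set 'rV[R]_m) (J : 'rV[R]_m -> 'M[R]_(m, N)).
Hypothesis (odom : open dom) (sJ : smooth dom J).

Section Gauss.
Variable B : 'M[R]_(N, m).

Let Bdom : set 'rV[R]_m := [set u | dom u /\ \det (J u *m B) != 0].

(* The rows of [gauss_map u] form the basis of the row space of [J u] that is
   dual to the columns of [B]; it only depends on that row space. *)
Definition gauss_map u : 'M[R]_(m, N) := invmx (J u *m B) *m J u.
Local Notation G := gauss_map.

Let sJB : smooth dom (fun u => J u *m B).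
Proof. by move=> k; apply: cont_diff_mulmx => //; exact: cont_diff_cst. Qed.

Let oBdom : open Bdom.
Proof.
have cdet : cont_diff 0 dom (fun u => \det (J u *m B)).
  apply: cont_diff_det => // i j.
  by have /(cont_diff_mxP _ _ odom) := sJB 0; exact.
exact: (open_setI_preimage odom (@open_neq R 0) cdet).
Qed.

Let sub_Bdom : Bdom `<=` dom. Proof. by move=> u []. Qed.

Let unit_JB u : Bdom u -> J u *m B \in unitmx.
Proof. by case=> _; rewrite unitmxE unitfE. Qed.

Let sG : smooth Bdom G.
Proof.
move=> k; apply: cont_diff_mulmx => //; last exact: cont_diff_sub (sJ k).
by apply: cont_diff_invmx => //; exact: cont_diff_sub (sJB k).
Qed.

Let dG u : Bdom u -> differentiable G u.
Proof. by move: u; have [] := sG 1. Qed.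

Let JBG u : Bdom u -> J u *m B *m G u = J u.
Proof. by move=> /unit_JB Pu; rewrite mulKVmx. Qed.

Let dJ u : dom u -> differentiable J u.
Proof. by move: u; have [] := sJ 1. Qed.

Let derive_JBG u v : Bdom u ->
  'D_v J u = 'D_v J u *m B *m G u + J u *m B *m 'D_v G u.
Proof.
move=> Bu; have Vu := sub_Bdom Bu.
transitivity ('D_v (fun u => J u *m B *m G u) u).
  apply: near_eq_derive; apply: filterS (near_open oBdom Bu) => y By.
  by rewrite JBG.
have dJB : differentiable (fun u => J u *m B) u.
  by apply: differentiable_mulmx => //; exact: dJ.
rewrite derive_mulmx//; last exact: dG.
rewrite (derive_mulmx _ (G := cst B))//; last exact: dJ.
by rewrite derive_cst mulmx0 addr0.
Qed.

(** Write ['D_v J u] as [C J]. As [J B G = J], the first term of [derive_JBG] is again [C J]; hence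
    [J B 'D_v G] vanishes, and [J B] is invertible. *)
Let derive_gauss_map_eq0 u v : Bdom u -> ('D_v J u <= J u)%MS -> 'D_v G u = 0.
Proof.
move=> Bu /submxP[C CE]; have := derive_JBG v Bu.
have JBG' : J u *m (B *m G u) = J u by rewrite mulmxA JBG.
rewrite CE -!mulmxA JBG' => E.
have H : J u *m (B *m 'D_v G u) = 0.
  by apply: (addrI (C *m J u)); rewrite addr0 -E.
by rewrite -[LHS](mulKmx (unit_JB Bu)) -(mulmxA (J u)) H mulmx0.
Qed.

Variables (p : nat) (W : 'M[R]_(p, N)) (z : 'rV[R]_N).
Variables (I : set R) (b : R -> 'rV[R]_m) (t0 : R).
Hypothesis rankJ : forall u, dom u -> exists X : 'M[R]_(N, m),
  (m - 1 <= \rank X)%N /\ forall i, ('D_(row i X) J u <= J u)%MS.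
Hypothesis (oI : open I) (It0 : I t0) (sb : smooth I b).
Hypothesis bdom : forall t, I t -> dom (b t).
Hypothesis JbW : forall t, I t -> J (b t) *m W^T = 0.
Hypothesis JB1 : J (b t0) *m B = 1%:M.
Hypothesis Jz : J (b t0) *m z^T = 0.
Hypothesis bbz : 0 < ('D_1 b t0 *m 'D_('D_1 b t0) J (b t0) *m z^T) 0 0.

Let v := 'D_1 b t0.
Let h u := (v *m G u *m z^T) 0 0.

Let smooth_entry k q r (A : 'M[R]_(q, m)) (C : 'M[R]_(N, r)) i j :
  cont_diff k Bdom (fun u => (A *m G u *m C) i j).
Proof.
have : cont_diff k Bdom (fun u => A *m G u *m C).
  apply: cont_diff_mulmx => //; last exact: cont_diff_cst.
  by apply: cont_diff_mulmx => //; exact: cont_diff_cst.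
by move=> /(cont_diff_mxP _ _ oBdom).
Qed.

Let derive_entryG q r (A : 'M[R]_(q, m)) (C : 'M[R]_(N, r)) i j u w : Bdom u ->
  'D_w (fun u => (A *m G u *m C) i j) u = (A *m 'D_w G u *m C) i j.
Proof.
move=> Bu; have dAG : differentiable (fun u => A *m G u) u.
  by apply: differentiable_mulmx; [exact: differentiable_cst|exact: dG].
rewrite -derive_entry; last first.
  by apply: differentiable_mulmx => //; exact: differentiable_cst.
rewrite (derive_mulmx _ (G := cst C))// derive_cst mulmx0 addr0.
rewrite (derive_mulmx _ (F := cst A))//; last exact: dG.
by rewrite derive_cst mul0mx add0r.
Qed.

Let Bt0 : Bdom (b t0).
Proof. by split; [exact: bdom|rewrite JB1 det1 oner_neq0]. Qed.

(** At [b t0], [J B = 1] gives [G = J], so [Jz] kills the first term of [derive_JBG]; what remains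
    is the positive quantity of [bbz]. *)
Let derive_h0 : 0 < 'D_v h (b t0).
Proof.
have -> : 'D_v h (b t0) = _ := derive_entryG v z^T 0 0 v Bt0; have := bbz.
rewrite -/v (derive_JBG v Bt0) JB1 mul1mx mulmxDr mulmxDl.
have -> : G (b t0) = J (b t0) by rewrite /gauss_map JB1 invmx1 mul1mx.
by rewrite -!mulmxA Jz !mulmx0 add0r.
Qed.

Let Hdom : set 'rV[R]_m := [set u | Bdom u /\ 'D_v h u != 0].

Let oHdom : open Hdom.
Proof.
have [_ /(_ v) cdh] := smooth_entry 1 v z^T 0 0.
by have := open_setI_preimage oBdom (@open_neq R 0) cdh.
Qed.

Lemma rank_one_jacobian_annihilates : \forall y \near b t0, J y *m W^T = 0.
Proof.
have sI : smooth Hdom h.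
  by move=> k; apply: cont_diff_sub (smooth_entry k v z^T 0 0) => u [].
have dh u : Hdom u -> differentiable h u.
  by move: u; have [] := sI 1.
have Ht0 : Hdom (b t0) by split=> //; rewrite gt_eqF// derive_h0.
have h0 : 0 < 'd h (b t0) ('D_1 b t0) by rewrite -deriveE//; exact: dh.
pose I' := [set t | I t /\ Bdom (b t)].
have cb := cont_diff_continuous (sb 0).
have oI' : open I' by exact: open_setI_preimage.
have I't0 : I' t0 by [].
have sb' : cont_diff 1 I' b by apply: cont_diff_sub (sb 1) => t [].
have := C1_level_set_meets_curve oHdom oI' Ht0 I't0 (sI 1) sb' h0.
apply: filterS2 (near_open oBdom Bt0) => y By [t [It Bt] gt].
(* [J y] is an invertible matrix times [G y], so [G] can replace [J]. *)
suff GW : G y *m W^T = 0 by rewrite -(JBG By) -mulmxA GW mulmx0.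
apply/matrixP => i k.
(* [b t] lies on the level of [h] through [y], so functions whose differential is everywhere a
   multiple of that of [h] agree at both points. *)
have -> : (G y *m W^T) i k = (G (b t) *m W^T) i k.
  rewrite -[G y]mul1mx -[G (b t)]mul1mx.
  apply: (gt (fun u => (1%:M *m G u *m W^T) i k)) => u [Bu hu].
  have dg : differentiable (fun u => (1%:M *m G u *m W^T) i k) u.
    by have [dg _] := smooth_entry 1 1%:M W^T i k; exact: dg.
  split=> //; have [X [rX XJ]] := rankJ (sub_Bdom Bu).
  (* [G] is stationary along the rows of [X], so all these gradients lie in the kernel of [X]. *)
  have Xgrad q r (A : 'M[R]_(q, m)) (C : 'M[R]_(N, r)) a c :
      X *m grad (fun u => (A *m G u *m C) a c) u = 0.
    have [dk _] := smooth_entry 1 A C a c.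
    apply/colP => l.
    transitivity ((row l X *m grad (fun u => (A *m G u *m C) a c) u) 0 0).
      by rewrite -row_mul [in RHS]mxE.
    rewrite -diff_grad; last exact: dk.
    rewrite -deriveE; last exact: dk.
    by rewrite derive_entryG// derive_gauss_map_eq0// mulmx0 mul0mx !mxE.
  have dhu := dh u (conj Bu hu).
  have gh0 : grad h u != 0.
    apply/eqP => gh0; move/eqP: hu; apply.
    by rewrite deriveE// diff_grad// gh0 mulmx0 mxE.
  have [mu gE] := corank1_kernel_colinear rX (Xgrad _ _ v z^T 0 0)
    (Xgrad _ _ 1%:M W^T i k) gh0.
  exists mu => w; rewrite !diff_grad//.
  by rewrite gE -scalemxAr mxE.
by rewrite /gauss_map -mulmxA JbW// mulmx0 !mxE.
Qed.

End Gauss.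
End RankOneJacobian.

(** * The solution near one point of the curve *)

Section LocalReduction.
Context {R : realType} {m n : nat}.

Lemma near_curve_in_affine (I : set R) (gamma : R -> 'rV[R]_(m + n))
    (D : R -> 'M[R]_(m + n)) (M : set 'rV[R]_(m + n)) (p : nat)
    (W : 'M[R]_(p, m + n)) (t0 : R) :
  open I -> smooth I gamma -> cauchy_solution I gamma D M ->
  (forall t (v : 'rV[R]_(m + n)), I t -> (v <= D t)%MS -> v *m W^T = 0) ->
  I t0 -> \rank (D t0) = m ->
  proj_perp (D t0) (derive1 (derive1 gamma) t0) != 0 ->
  exists O : set 'rV[R]_(m + n), [/\ open O, O (gamma t0) &
    forall q, M q -> O q -> (q - gamma t0) *m W^T = 0].
Proof.
move=> oI sgam [r1 Mgam Tgam] DW It0 rD curv.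
have [U [V [f [g [[oU Ut0 oV] [sf sg] gf fg slice]]]]] := r1.1 _ (Mgam t0 It0).
pose psi := chart_param g; pose dom := chart_dom (m := m) V; pose J := chart_jac g.
have odom : open dom by exact: open_chart_dom.
have sJ : smooth dom J by exact: smooth_chart_jac.
have coord q (Uq : U q) (Mq : M q) := chart_coord gf slice Uq Mq.
have tanE u : dom u -> tangent_space M (psi u) = [set v | (v <= J u)%MS].
  exact: (tangent_space_chart oU oV sf sg gf fg slice).
pose b t := lsubmx (f (gamma t)).
pose I' := [set t | I t /\ U (gamma t)].
have oI' : open I'.
  by apply: open_setI_preimage => //; exact: cont_diff_continuous (sgam 0).
have I't0 : I' t0 by [].
have bdom t : I' t -> dom (b t) by move=> [It Ut]; case: (coord _ Ut (Mgam t It)).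
have psib t : I' t -> psi (b t) = gamma t.
  by move=> [It Ut]; case: (coord _ Ut (Mgam t It)).
have sb : smooth I' b.
  move=> k; apply: (@cont_diff_linear _ _ _ _ _ _ (fun t => f (gamma t)) lsubmx) => //.
    exact: continuous_lsubmx.
  apply: (@cont_diff_comp _ _ _ _ _ _ U gamma f) => // [t []//|].
  by apply: cont_diff_sub (sgam k) => t [].
have db t : I' t -> differentiable b t by move: t; have [] := sb 1.
have DJ t : I' t -> (D t :=: J (b t))%MS.
  move=> I't; apply/eqmxP/andP; split; apply/rV_subP => u uD.
    have : tangent_space M (gamma t) u by rewrite (Tgam t I't.1).
    by rewrite -(psib t I't) tanE//; exact: bdom.
  have : tangent_space M (psi (b t)) u by rewrite tanE//; exact: bdom.
  by rewrite (psib t I't) (Tgam t I't.1).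
have dgam t : I' t -> 'D_1 gamma t = 'D_1 b t *m J (b t).
  move=> [It Ut]; apply: (derive_chart_curve oU oV sf sg gf slice) => //.
    by have [dg _] := sgam 1; exact: dg.
  by apply: filterS (near_open oI It) => t' /Mgam.
pose v := 'D_1 b t0.
(* The first term is tangent at [gamma t0], so only [v *m 'D_v J (b t0)] contributes to the normal
   part of the acceleration. *)
have d2gam : derive1 (derive1 gamma) t0 =
    'D_1 ('D_1 b) t0 *m J (b t0) + v *m 'D_v J (b t0).
  have -> : derive1 gamma = 'D_1 gamma by apply/funext => t; exact: derive1E.
  rewrite derive1E; transitivity ('D_1 (fun t => 'D_1 b t *m J (b t)) t0).
    by apply: near_eq_derive; apply: filterS (near_open oI' I't0) => t /dgam.
  have dJ : differentiable J (b t0) by have [dJ _] := sJ 1; exact/dJ/bdom.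
  have dJb : differentiable (fun t => J (b t)) t0.
    by apply: (@differentiable_comp _ _ _ _ b J) => //; exact: db.
  have d2b : differentiable ('D_1 b) t0.
    by have [_ /(_ 1)[d2b _]] := sb 2; exact: d2b.
  rewrite (derive_mulmx (1 : R) d2b dJb).
  by rewrite (derive_comp (1 : R) (db t0 I't0) dJ).
have [topD perpD projE] := proj_top_perp (D t0) (derive1 (derive1 gamma) t0).
set z := proj_perp _ _ in curv perpD projE; clearbody z.
have perp_z (u : 'rV[R]_(m + n)) : (u <= D t0)%MS -> u *m z^T = 0.
  move=> uD; have /orth_complP/(_ u uD) zu := perpD.
  by rewrite -[LHS]trmxK trmx_mul trmxK zu trmx0.
have Jz : J (b t0) *m z^T = 0.
  by apply/row_matrixP => i; rewrite row_mul row0 perp_z// (DJ t0 I't0) row_sub.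
have rfJ : row_free (J (b t0)) by rewrite /row_free -(DJ t0 I't0) rD.
(* This number is the squared Euclidean norm of [z], positive by the curvature hypothesis. *)
have bbz : 0 < (v *m 'D_v J (b t0) *m z^T) 0 0.
  have -> : v *m 'D_v J (b t0) *m z^T = z *m z^T.
    have := congr1 (mulmx^~ z^T) d2gam; rewrite -[LHS]/(_ *m _) -projE /=.
    by rewrite !mulmxDl perp_z// -!mulmxA Jz mulmx0 !add0r.
  rewrite lt_neqAle eq_sym; apply/andP; split.
    apply: contra_neq curv => zz; apply: dotmx_eq0.
    by apply/matrixP => i j; rewrite !ord1 zz mxE.
  by rewrite mxE sumr_ge0// => i _; rewrite mxE -expr2 sqr_ge0.
have JbW t : I' t -> J (b t) *m W^T = 0.
  move=> I't; apply/row_matrixP => i; rewrite row_mul row0.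
  by apply: (DW t) I't.1 _; rewrite (DJ t I't) row_sub.
have rankJ u : dom u -> exists X : 'M[R]_(m + n, m), (m - 1 <= \rank X)%N /\
    forall i, ('D_(row i X) J u <= J u)%MS.
  exact: (rank_one_chart oU oV sf sg gf fg slice r1).
(* The matrix [B] is the pseudo-inverse of [J (b t0)], a right inverse because that Jacobian has
   full row rank. *)
have := rank_one_jacobian_annihilates odom sJ rankJ oI' I't0 sb bdom JbW
  (mulmxVp rfJ) Jz bbz.
have nd := near_open odom (bdom t0 I't0).
move=> /(filterI nd)/nbhs_distP[r r0 JW].
(* In a coordinate ball the segment from the center to any point stays where [W] annihilates the
   Jacobian, so [psi *m W^T] is constant along it. *)
exists [set q | U q /\ ball (b t0) r (lsubmx (f q))]; split.
- apply: (@open_setI_preimage R _ _ U (fun q => lsubmx (f q)) _ oU).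
    exact: ball_open.
  move=> q Uq; apply: differentiable_continuous.
  exact: (differentiable_chart_coord sf Uq).
- by split=> //; exact: ballxx.
move=> q Mq [Uq]; have [_ E] := coord q Uq Mq.
rewrite -[X in X - _]E {E}; move: (lsubmx (f q)) => y.
rewrite -ball_normE /= distrC => yr.
rewrite -(psib t0 I't0); apply/matrixP => i k.
rewrite mulmxBl [LHS]mxE [X in _ + X]mxE [RHS]mxE.
pose l (c : R) := b t0 + c *: (y - b t0).
have l0 : l 0 = b t0 by rewrite /l scale0r addr0.
have l1 : l 1 = y by rewrite /l scale1r addrC subrK.
have ldom (c : R) : 0 <= c <= 1 -> `|l c - b t0| < r.
  move=> /andP[c0 c1]; rewrite /l addrC addKr normrZ ger0_norm//.
  by apply: le_lt_trans yr; rewrite ler_piMl.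
have dl (c : R) : is_diff c l (fun t => t *: (y - b t0)).
  by have := is_diffD (is_diff_cst (b t0) c) (is_diff_scalel c (y - b t0));
    rewrite add0r.
have dpsi (c : R) : 0 <= c <= 1 -> differentiable psi (l c).
  move=> /ldom/JW[Vl _]; exact: (differentiable_chart_param oV sg).
have dpsil (c : R) : 0 <= c <= 1 -> differentiable (fun c => psi (l c)) c.
  by move=> c01; apply: (@differentiable_comp _ _ _ _ l psi) => //; exact: dpsi.
have dpW (c : R) : 0 <= c <= 1 -> differentiable (fun c => psi (l c) *m W^T) c.
  by move=> c01; apply: differentiable_mulmx => //; exact: dpsil.
have iI : is_interval [set c : R | 0 <= c <= 1].
  by move=> x x' /= /andP[? ?] /andP[? ?] w /andP[? ?]; apply/andP; split; lra.
have := @derivable_0_cst R (fun c => (psi (l c) *m W^T) i k) _ iI.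
move=> /(_ _ _ 1 0); rewrite l1 l0 => ->.
- by rewrite subrr.
- by move=> c c01; apply: diff_derivable; exact/differentiable_entry/dpW.
- move=> c c01; rewrite -derive_entry; last exact: dpW.
  rewrite (derive_mulmx _ (G := cst W^T))//; last exact: dpsil.
  rewrite derive_cst mulmx0 addr0 deriveE; last exact: dpsil.
  rewrite (@diff_comp _ _ _ _ l psi)//; last exact: dpsi.
  have [Vl JW0] := JW _ (ldom c c01).
  rewrite /= diff_val scale1r -deriveE; last exact: dpsi.
  by rewrite (derive_chart_param oV sg)// -mulmxA JW0 mulmx0 mxE.
- by rewrite /= ler01 lexx.
- by rewrite /= lexx ler01.
Qed.

End LocalReduction.

(** * Gluing the local neighborhoods along the curve *)

Theorem proposition5p2 (R : realType) (m n : nat) (hm : (2 <= m)%N)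
    (hn : (1 <= n)%N) (I : set R) (gamma : R -> 'rV[R]_(m + n))
    (D : R -> 'M[R]_(m + n)) (N : 'I_n -> R -> 'rV[R]_(m + n)) (s : 'I_n)
    (hI : is_interval I) (Iopen : open I) (I0 : I !=set0)
    (hgamma : regular_embedded_curve I gamma)
    (hD : smooth_distribution I D)
    (htan : forall t, I t -> (derive1 gamma t <= D t)%MS)
    (hcurv : forall t, I t -> proj_perp (D t) (derive1 (derive1 gamma) t) != 0)
    (hN : smooth_orthonormal_normal_frame I D N)
    (htop : forall k, k != s ->
       forall t, I t -> proj_top (D t) (derive1 (N k) t) = 0)
    (hperp : forall t, I t -> proj_perp (D t) (derive1 (N s) t) = 0)
    (M : set 'rV[R]_(m + n)) (hM : cauchy_solution I gamma D M) :
  exists U : set 'rV[R]_(m + n),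
    [/\ open U,
        (forall t, I t -> U (gamma t)),
        ((2 <= n)%N -> ~ full (M `&` U)) &
        exists p A, hypersurface_of_affine_subspace (M `&` U) p A].
Proof.
have [t0 It0] := I0; have [sgam _ _ _] := hgamma.
pose W := other_normals N s t0.
have DW t (v : 'rV[R]_(m + n)) : I t -> (v <= D t)%MS -> v *m W^T = 0.
  exact: (other_normals_perp hI Iopen hN htop hperp It0).
have loc t : I t -> exists Q : set 'rV[R]_(m + n), [/\ open Q, Q (gamma t) &
    forall q, M q -> Q q -> (q - gamma t) *m W^T = 0].
  move=> It; apply: (near_curve_in_affine Iopen sgam hM DW It) (hcurv t It).
  have [K [E [_ Kt _ _ /(_ t Kt)[rfE ED]]]] := hD t It.
  by rewrite -(eqmxP ED); exact/eqP.
(* The single base point [gamma t0] serves all of these sets, so their union still works. *)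
pose Mloc Q := [/\ open Q & forall q, M q -> Q q -> (q - gamma t0) *m W^T = 0].
have gamW t : I t -> (gamma t - gamma t0) *m W^T = 0.
  move=> It; apply/matrixP => i k.
  rewrite mulmxBl [LHS]mxE [X in _ + X]mxE [RHS]mxE.
  have dg x : I x -> differentiable gamma x by move: x; have [] := sgam 1.
  have dgW x : I x -> differentiable (fun x => gamma x *m W^T) x.
    by move=> Ix; apply: differentiable_mulmx => //; exact: dg.
  rewrite (@derivable_0_cst R (fun x => (gamma x *m W^T) i k) I hI _ _ t t0)//.
  - by rewrite subrr.
  - by move=> x Ix; apply: diff_derivable; exact/differentiable_entry/dgW.
  move=> x Ix; rewrite -derive_entry; last exact: dgW.
  rewrite (derive_mulmx _ (G := cst W^T))//; last exact: dg.
  by rewrite derive_cst mulmx0 addr0 -derive1E (DW x)// ?mxE//; exact: htan.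
pose U := \bigcup_(Q in [set Q | Mloc Q]) Q.
have oU : open U by apply: bigcup_open => Q [].
have MU : (M `&` U) `<=` affine_subspace (gamma t0) (kermx W^T).
  by move=> q [Mq [Q [_ QW] Qq]]; apply/sub_kermxP; exact: QW.
have rW : \rank (kermx W^T) = m.+1.
  rewrite mxrank_ker mxrank_tr.
  have /eqP -> : row_free W.
    by apply/row_freeP; exists W^T; exact: (other_normals_orthonormal s hN It0).
  (* [W] has [n.-1] independent rows and [n] is positive, so the rank is
     [m + n - (n - 1) = m + 1]. *)
  by rewrite -subn1 subnBA// addnAC addnK addn1.
exists U; split=> //.
- move=> t It; have [Q [oQ Qt QW]] := loc t It; exists Q => //; split=> // q Mq Qq.
  (* [q - gamma t0] splits at [gamma t] into a part controlled by [loc] and a part controlled by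
     [gamW]. *)
  by rewrite -[q](subrK (gamma t)) -addrA mulmxDl QW// gamW// addr0.
(* For [n = 1] the affine subspace is all of the ambient space; [n2] gives [m + 1 < m + n]. *)
- move=> n2; apply; exists (gamma t0), (kermx W^T); split=> //.
  by rewrite rW -addn1 ltn_add2l.
exists (gamma t0), (kermx W^T); split=> //.
move=> p [Mp Up]; have [[eM _] _ _] := hM.
have [U' [V' [f [g [[oU' U'p oV'] [sf sg] gf fg slice]]]]] := eM p Mp.
(* A slice chart of [M] restricted to the open set [U] is a slice chart of the intersection, once
   its image is cut down to the points that [g] sends into [U]. *)
exists (U' `&` U), [set w | V' w /\ U (g w)], f, g; split.
- split; [exact: openI|by []|].
  by apply: open_setI_preimage => //; exact: cont_diff_continuous (sg 0).
- split=> k; first by apply: cont_diff_sub (sf k) => q [].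
  by apply: cont_diff_sub (sg k) => q [].
- by move=> q [U'q Uq]; have [Vq gq] := gf q U'q; rewrite /mkset gq.
- by move=> w [V'w Uw]; have [U'w fw] := fg w V'w.
by move=> q [U'q Uq]; split=> [[Mq _]|/(slice q U'q)//]; exact/(slice q U'q).
Qed.
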